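(* If $G$ is a claw-free bridgeless cubic graph, then $\chi'_{N}(G)\leq 6$.
   Context: Graphs are finite, undirected, without loops, possibly with parallel edges. A graph is claw-free if it has no four vertices inducing a subgraph isomorphic to $K_{1,3}$. A $k$-edge-coloring is a proper edge-coloring with colors from $\{1,\dots,k\}$. For an edge-coloring $c$ and a vertex $v$, let $S_c(v)$ be the set of colors on the edges incident with $v$. An edge $uv$ of a cubic graph is poor if $|S_c(u)\cup S_c(v)|=3$, rich if $|S_c(u)\cup S_c(v)|=5$, and normal if it is poor or rich. An edge-coloring is normal if every edge is normal. $\chi'_N(G)$ denotes the smallest $k$ such that $G$ admits a normal $k$-edge-coloring. *)

(* Defs.v *)
From mathcomp Require Import all_boot.

Set Implicit Arguments.
Unset Strict Implicit.
Unset Printing Implicit Defensive.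

(* Finite undirected loopless multigraphs: [ends] need not be injective, so
   parallel edges are allowed, and [#|ends e| = 2] excludes loops. *)
Record mgraph := MGraph {
  vertex : finType;
  edge : finType;
  ends : edge -> {set vertex};
  card_ends : forall e, #|ends e| = 2
}.

Definition incident (G : mgraph) (v : vertex G) : {set edge G} :=
  [set e | v \in ends e].

Definition cubic (G : mgraph) : Prop :=
  forall v : vertex G, #|incident v| = 3.

Definition adj (G : mgraph) (F : {set edge G}) : rel (vertex G) :=
  [rel x y | [exists e in F, ends e == [set x; y]]].

(* [n_comp] counts components only for relations whose closure is symmetric. *)
Lemma adj_sym (G : mgraph) (F : {set edge G}) : symmetric (adj F).
Proof. by move=> x y; apply: eq_existsb => e; rewrite setUC. Qed.

Definition num_components (G : mgraph) (F : {set edge G}) : nat :=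
  n_comp (adj F) predT.

Definition bridge (G : mgraph) (e : edge G) : bool :=
  num_components [set: edge G] < num_components [set~ e].

Definition bridgeless (G : mgraph) : Prop := forall e : edge G, ~~ bridge e.

Section Induced.
Variables (G : mgraph) (W : {set vertex G}).

Definition induced_ends (e : {e : edge G | ends e \subset W}) :
  {set {x : vertex G | x \in W}} := [set x | val x \in ends (val e)].

Lemma card_induced_ends e : #|induced_ends e| = 2.
Proof.
rewrite -(card_ends (val e)) -(card_imset _ val_inj).
apply: eq_card => x; apply/imsetP/idP => [[y + ->]|xe]; first by rewrite inE.
by exists (Sub x (subsetP (valP e) x xe)); rewrite ?inE.
Qed.

Definition induced : mgraph := MGraph card_induced_ends.

End Induced.

Definition isomorphic (G H : mgraph) : Prop :=
  exists (f : vertex G -> vertex H) (g : edge G -> edge H),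
    [/\ bijective f, bijective g & forall e, ends (g e) = f @: ends e].

(* The claw $K_{1,3}$: centre 0, leaves 1, 2, 3. *)
Definition claw_ends (i : 'I_3) : {set 'I_4} := [set ord0; lift ord0 i].

Lemma card_claw_ends i : #|claw_ends i| = 2.
Proof. by rewrite cards2 neq_lift. Qed.

Definition claw : mgraph := MGraph card_claw_ends.

Definition claw_free (G : mgraph) : Prop :=
  ~ exists2 W : {set vertex G}, #|W| = 4 & isomorphic (induced W) claw.

Section Coloring.
Variables (G : mgraph) (k : nat) (c : edge G -> 'I_k).

Definition proper_coloring : Prop :=
  forall e f : edge G, e != f -> ends e :&: ends f != set0 -> c e != c f.

Definition colors_at (v : vertex G) : {set 'I_k} := c @: incident v.

Definition end_colors (e : edge G) : {set 'I_k} :=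
  \bigcup_(v in ends e) colors_at v.

Definition poor (e : edge G) : bool := #|end_colors e| == 3.
Definition rich (e : edge G) : bool := #|end_colors e| == 5.

Definition normal_coloring : Prop :=
  proper_coloring /\ forall e, poor e || rich e.

End Coloring.

Definition normal_colorable (G : mgraph) (k : nat) : Prop :=
  exists c : edge G -> 'I_k, normal_coloring c.

(* The normal chromatic index is a relation, not a function into [nat],
   because a cubic multigraph with bridges may have no normal coloring. *)
Definition is_normal_chromatic_index (G : mgraph) (k : nat) : Prop :=
  normal_colorable G k /\ forall j, normal_colorable G j -> k <= j.

(* Main.v *)
Require Import Defs.
From mathcomp Require Import all_boot zify.

(* Every vertex of a claw-free cubic graph lies on a digon or a triangle. A
   digon, a diamond, or a component with two or four vertices is a piece left
   by at most two edges, and it can be removed, its two outgoing edges being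
   merged: a normal colouring of the smaller graph extends to the piece using
   only the three colours present at one end of the merged edge.

   Otherwise the vertices are partitioned into disjoint triangles. Contract them
   and, by Petersen's theorem, colour a perfect matching of the contracted
   graph with 5 and its complementary 2-factor properly with 0, 1, 2. The
   three remaining colours at each contracted vertex are assigned to its
   triangle so that an edge of the triangle is always rich; an edge coloured 5
   sees {3,4} at both ends, and an edge coloured p in {0,1,2} sees at each
   end one of the disjoint pairs {p+2,3} and {p+1,4} (mod 3). *)

Set Implicit Arguments.
Unset Strict Implicit.
Unset Printing Implicit Defensive.

(** Bridgelessness is used as the absence of cuts with exactly one edge, because cuts pull back
    along both the removal of a piece and the contraction of triangles. The same condition keeps a
    merged edge from becoming a loop. If every vertex of a removed piece sees the three colours
    present at one end of the merged edge, then all edges of the piece and the half at that end are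
    poor, while the other half sees what the merged edge saw. Contracting triangles may create
    parallel edges and claws, so Petersen's theorem is needed for all bridgeless cubic multigraphs;
    it is obtained here from Gallai's lemma. Each triangle is coloured knowing only its own three
    outer colours, so the two ends of an outer edge are coloured independently. This works if the
    pairs that can be seen next to a given outer colour are always equal (a poor edge) or disjoint
    (a rich one). *)

Lemma card3_ex (T : finType) (A : {set T}) : #|A| = 3 ->
  exists x y z, A = [set x; y; z] /\ uniq [:: x; y; z].
Proof.
move=> A3; have := enum_uniq (mem A); have : size (enum A) = 3 by rewrite -cardE.
case E: (enum A) => [|x [|y [|z []]]] // _ xyz; exists x, y, z; split=> //.
by apply/setP=> t; rewrite -mem_enum E !inE orbA.
Qed.

Lemma card_set3 (T : finType) (x y z : T) :
  x != y -> x != z -> y != z -> #|[set x; y; z]| = 3.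
Proof.
by move=> xy xz yz; rewrite setUC cardsU1 cards2 xy !inE negb_or eq_sym xz eq_sym yz.
Qed.

(** * Edge cuts *)

Section Cuts.
Variable G : mgraph.
Implicit Types (v x y : vertex G) (e f : edge G) (S W : {set vertex G}).
Implicit Types (F M N : {set edge G}).

Definition cut S : {set edge G} := [set e | #|ends e :&: S| == 1].

Lemma other_end e x : x \in ends e -> exists2 y, y != x & ends e = [set x; y].
Proof.
move=> xe; have: #|ends e :\ x| == 1.
  by have := cardsD1 x (ends e); rewrite card_ends xe; lia.
case/cards1P=> y eq_y; exists y; last by rewrite -(setD1K xe) eq_y.
by have := set11 y; rewrite -eq_y !inE => /andP[].
Qed.

Lemma ends_pair e : exists x y, x != y /\ ends e = [set x; y].
Proof.
have: 0 < #|ends e| by rewrite card_ends.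
by case/card_gt0P=> x /other_end[y yx ->]; exists x, y; rewrite eq_sym.
Qed.

Lemma cutP e x y S : ends e = [set x; y] -> x != y ->
  (e \in cut S) = ((x \in S) (+) (y \in S)).
Proof.
move=> e_xy xy; rewrite inE e_xy setIUl cardsU.
have -> : [set x] :&: S :&: ([set y] :&: S) = set0.
  apply/setP=> z; rewrite !inE.
  by have [->|] := eqVneq z x; rewrite //= (negbTE xy) !andbF.
rewrite cards0 subn0.
have c1 z : #|[set z] :&: S| = (z \in S).
  case: (boolP (z \in S)) => zS; first by rewrite (setIidPl _) ?sub1set ?cards1.
  by apply/eqP; rewrite cards_eq0 setI_eq0 disjoints1.
by rewrite !c1; do 2 case: (_ \in S).
Qed.

Lemma handshake F S :
  \sum_(v in S) #|incident v :&: F| = \sum_(e in F) #|ends e :&: S|.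
Proof.
transitivity (\sum_(v in S) \sum_(e in F) (v \in ends e : nat)).
  apply: eq_bigr => v _; rewrite -sum1_card big_mkcond [RHS]big_mkcond; apply: eq_bigr => e _.
  by rewrite !inE; do 2 case: (_ \in _).
rewrite exchange_big; apply: eq_bigr => e _ /=.
rewrite -sum1_card big_mkcond [RHS]big_mkcond; apply: eq_bigr => v _.
by rewrite !inE; do 2 case: (_ \in _).
Qed.

(** Edges with both ends in [S] are counted twice, so modulo 2 only the cut edges of [F] remain. *)
Lemma handshake_parity F S :
  odd (\sum_(v in S) #|incident v :&: F|) = odd #|F :&: cut S|.
Proof.
rewrite handshake -sum1_card big_mkcond [in RHS]big_mkcond /=.
elim/big_ind2: _ => // [m1 n1 m2 n2|e _]; first by rewrite !oddD => -> ->.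
rewrite !inE; case: (e \in F) => //=; have : #|ends e :&: S| <= 2.
  by rewrite -(card_ends e) subset_leq_card ?subsetIl.
by case: #|_| => [|[|[|]]].
Qed.

Lemma cut_closed_connect e x y S : cut S = [set e] -> x \in S ->
  connect (adj [set~ e]) x y -> y \in S.
Proof.
move=> cutS xS xy; suff cl : closed (adj [set~ e]) (mem S).
  by rewrite -(closed_connect cl xy).
apply: intro_closed; first exact/sym_connect_sym/adj_sym.
move=> u v /existsP[f /andP[fe /eqP ends_f]] uS.
have uv : u != v by have := card_ends f; rewrite ends_f cards2; case: eqP.
have := cutP S ends_f uv; rewrite cutS !inE in fe *.
by rewrite (negbTE fe) uS /=; case: (v \in S).
Qed.

(** If [e] were alone in the cut, its ends would lie in different components without [e]. Sending
    each component root without [e] to its root in [G] would then be onto but not injective, so [e]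
    would be a bridge. *)
Lemma bridgeless_cut S : bridgeless G -> #|cut S| != 1.
Proof.
move=> noB; apply/negP=> /cards1P[e cutS]; case/negP: (noB e).
have [x [y [xy ends_e]]] := ends_pair e.
have: (x \in S) (+) (y \in S) by rewrite -(cutP S ends_e xy) cutS set11.
wlog [xS yS] : x y xy ends_e / x \in S /\ y \notin S => [hw|_].
  case xS: (x \in S); case yS: (y \in S) => // _.
    by apply: (hw x y); rewrite ?xS ?yS.
  by apply: (hw y x); rewrite ?xS ?yS // 1?eq_sym // setUC.
rewrite /bridge /num_components /n_comp_mem.
set r := adj [set: _]; set r' := adj [set~ e].
have symr : connect_sym r by exact/sym_connect_sym/adj_sym.
have symr' : connect_sym r' by exact/sym_connect_sym/adj_sym.
have subr u v : connect r' u v -> connect r u v.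
  apply: connect_sub => {}u {}v /existsP[f /andP[_ fuv]].
  by apply/connect1/existsP; exists f; rewrite inE.
have rxy : connect r x y.
  by apply/connect1/existsP; exists e; rewrite inE ends_e /=.
have rootK u : root r (root r' u) = root r u.
  by apply/esym/eqP; rewrite (root_connect symr); apply/subr/connect_root.
pose R' := [set u | roots r' u].
have -> : #|predI (roots r) predT| = #|root r @: R'|.
  apply: eq_card => u; rewrite !inE andbT; apply/idP/imsetP => [ru|[v _ ->]].
    exists (root r' u); last by rewrite rootK; apply/esym/eqP.
    by rewrite inE; apply: roots_root.
  exact: roots_root.
have -> : #|predI (roots r') predT| = #|R'|.
  by apply: eq_card => u; rewrite !inE andbT.
rewrite ltn_neqAle leq_imset_card andbT; apply/negP=> /imset_injP injr.
have /eqP : root r' x = root r' y.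
  apply: injr; rewrite ?inE ?(roots_root symr') // !rootK.
  by apply/eqP; rewrite (root_connect symr).
rewrite (root_connect symr') => /(cut_closed_connect cutS xS).
by rewrite (negPf yS).
Qed.

End Cuts.

(** * Petersen's theorem *)

Section Matchings.
Variable G : mgraph.
Implicit Types (v x y : vertex G) (e f : edge G) (S W : {set vertex G}).
Implicit Types (F M N : {set edge G}).

Definition matching W M :=
  [forall e in M, ends e \subset W] && [forall v, #|incident v :&: M| <= 1].

Definition missed W M := [set v in W | incident v :&: M == set0].

Lemma matchingP W M :
  reflect ((forall e, e \in M -> ends e \subset W) /\
           (forall v e f, v \in ends e -> v \in ends f ->
              e \in M -> f \in M -> e = f))
          (matching W M).
Proof.
apply: (iffP andP) => [[/forall_inP sMW /forallP deg1]|[sMW deg1]]; split=> //.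
- move=> v e f ve vf eM fM; apply: (card_le1_eqP (deg1 v));
    by rewrite !inE ?ve ?vf.
- exact/forall_inP.
- apply/forallP=> v; apply/card_le1_eqP=> e f; rewrite !inE.
  by case/andP=> ve eM /andP[vf fM]; apply: (deg1 v).
Qed.

Lemma missedP W M v :
  reflect (v \in W /\ forall e, v \in ends e -> e \notin M) (v \in missed W M).
Proof.
rewrite inE; apply: (iffP andP) => -[vW]; split=> //.
  move=> e ve; apply/negP=> eM; have := in_set0 e.
  by rewrite -(eqP b) !inE ve eM.
by apply/eqP/setP=> e; rewrite !inE; apply/andP=> -[/b/negP].
Qed.

Lemma covered W M v : v \in W -> v \notin missed W M ->
  exists2 e, e \in M & v \in ends e.
Proof.
by rewrite inE => -> /set0Pn[e]; rewrite !inE => /andP[]; exists e.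
Qed.

Lemma matching0 W : matching W set0.
Proof. by apply/matchingP; split=> [e|v e f _ _]; rewrite inE. Qed.

(** Degrees in [M] are 0 at the missed vertices and 1 at the other vertices of [W]; their sum counts
    every edge of [M] twice. *)
Lemma card_missed W M : matching W M -> #|W| = #|missed W M| + 2 * #|M|.
Proof.
case/matchingP=> sMW deg1.
have <- : \sum_(e in M) #|ends e :&: W| = 2 * #|M|.
  rewrite mulnC -sum_nat_const; apply: eq_bigr => e /sMW/setIidPl->.
  exact: card_ends.
rewrite -handshake -!sum1_card big_mkcond [\sum_(_ in missed _ _) _]big_mkcond.
rewrite [X in _ = _ + X]big_mkcond -big_split; apply: eq_bigr => v _ /=.
have [vW|vW] := boolP (v \in W); last by rewrite inE (negPf vW).
have [/missedP[_ vM]|] := ifPn.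
  rewrite (_ : _ :&: _ = set0) ?cards0 //; apply/setP=> e.
  by rewrite !inE; apply/andP=> -[/vM/negP].
case/(covered vW)=> e eM ve; rewrite (_ : _ :&: _ = [set e]) ?cards1 //.
apply/setP=> f; rewrite !inE; apply/andP/eqP=> [[vf fM]|->] //.
exact: deg1 vf ve fM eM.
Qed.

Definition nu W := \max_(M | matching W M) #|M|.

Definition maximum W M := matching W M && (#|M| == nu W).

Lemma leq_nu W M : matching W M -> #|M| <= nu W.
Proof. exact: leq_bigmax_cond. Qed.

Lemma maximum_ex W : exists M, maximum W M.
Proof.
have [|M MW nuW] := @eq_bigmax_cond _ (matching W) (fun M => #|M|).
  by apply/card_gt0P; exists set0; apply: matching0.
by exists M; apply/andP; split=> //; apply/eqP/esym.
Qed.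

Lemma card_missed_maximum W M : maximum W M -> #|W| = #|missed W M| + 2 * nu W.
Proof. by case/andP=> MW /eqP<-; apply: card_missed. Qed.

Lemma matching_setU1 W M e : matching W M -> ends e \subset W ->
  (forall v, v \in ends e -> v \in missed W M) -> matching W (e |: M).
Proof.
case/matchingP=> sMW deg1 eW e_miss; apply/matchingP; split.
  by move=> f /setU1P[->|/sMW].
move=> v f g vf vg /setU1P[fe|fM] /setU1P[ge|gM].
- by rewrite fe ge.
- by rewrite fe in vf; case/missedP: (e_miss v vf) => _ /(_ g vg); rewrite gM.
- by rewrite ge in vg; case/missedP: (e_miss v vg) => _ /(_ f vf); rewrite fM.
- exact: (deg1 v).
Qed.

Lemma maximum_edge W M e x y : maximum W M -> ends e = [set x; y] ->
  x \in missed W M -> y \in missed W M -> False.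
Proof.
case/andP=> MW /eqP nuM eE xM yM.
have: matching W (e |: M).
  apply: matching_setU1 => // [|v].
    by rewrite eE subUset !sub1set; case/missedP: xM => -> _; case/missedP: yM.
  by rewrite eE => /set2P[]->.
move/leq_nu; rewrite -nuM cardsU1.
case/missedP: xM => _ /(_ e) -> ; first by rewrite add1n ltnn.
by rewrite eE set21.
Qed.

Lemma matching_sub W M N : N \subset M -> matching W M -> matching W N.
Proof.
move=> /subsetP sNM /matchingP[sMW deg1]; apply/matchingP; split=> [e /sNM/sMW //|].
by move=> v e f ve vf /sNM eM /sNM fM; apply: (deg1 v).
Qed.

(* An equivalence relation as soon as every vertex of [W] is missed by some
   maximum matching (Gallai's lemma). *)
Definition gallai W x y :=
  (x == y) || [forall M, maximum W M ==> ~~ ((x \in missed W M) && (y \in missed W M))].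

Lemma gallaiP W M x y : gallai W x y -> maximum W M ->
  x \in missed W M -> y \in missed W M -> x = y.
Proof.
case/orP=> [/eqP-> //|/forallP/(_ M)/implyP sim maxM xM yM].
by case/negP: (sim maxM); rewrite xM.
Qed.

Lemma gallai_sym W : symmetric (gallai W).
Proof.
move=> x y; rewrite /gallai eq_sym; congr (_ || _).
by apply: eq_forallb => M; rewrite andbC.
Qed.

Lemma gallai_edge W e x y : ends e = [set x; y] -> gallai W x y.
Proof.
move=> eE; apply/orP; right; apply/forallP=> M; apply/implyP=> maxM.
by apply/negP=> /andP[xM yM]; apply: maximum_edge maxM eE xM yM.
Qed.

(* Schrijver's exchange argument: a maximum matching [N] missing [t] that
   agrees with [M] as much as possible can be made to agree even more. *)
Lemma gallai_trans W t : (exists2 N, maximum W N & t \in missed W N) ->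
  forall u v, gallai W u t -> gallai W t v -> gallai W u v.
Proof.
move=> [N0 maxN0 tN0] u v ut tv.
have [//|uv] := eqVneq u v; first by rewrite /gallai => ->; rewrite eqxx.
apply/orP; right; apply/forallP=> M; apply/implyP=> maxM.
apply/negP=> /andP[uM vM].
pose P N := maximum W N && (t \in missed W N).
have PN0 : P N0 by rewrite /P maxN0.
case: (@arg_maxnP _ N0 P (fun N => #|N :&: M|) PN0) => N /andP[maxN tN] bestN.
have NW := andP maxN; have MW := andP maxM.
have tM : t \notin missed W M.
  apply/negP=> tM; case/negP: uv.
  by rewrite (gallaiP ut maxM uM tM) (gallaiP tv maxM tM vM).
have uN : u \notin missed W N.
  by apply: contra tM => uN; rewrite -(gallaiP ut maxN uN tN).
have vN : v \notin missed W N.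
  by apply: contra tM => vN; rewrite (gallaiP tv maxN tN vN).
(* Both matchings miss equally many vertices, and [u], [v] are missed by [M] only. Hence at least
   two vertices are missed by [N] only, and one of them is not [t]. *)
have [x [xt xN xM]] : exists x, [/\ x != t, x \in missed W N & x \notin missed W M].
  pose A := missed W M :\: missed W N; pose B := missed W N :\: missed W M.
  have cAB : #|A| = #|B|.
    have cMN : #|missed W M| = #|missed W N|.
      by apply: (@addIn (2 * nu W)); rewrite -!card_missed_maximum.
    apply: (@addnI #|missed W M :&: missed W N|).
    by rewrite cardsID [in RHS]setIC cardsID.
  have: 1 < #|A|.
    apply: (@leq_trans #|[set u; v]|); first by rewrite cards2 uv.
    apply: subset_leq_card.
    by rewrite subUset !sub1set !in_setD uN vN uM vM.
  rewrite cAB => /card_gt1P[x [y [xB yB xy]]].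
  have [xt|xt] := eqVneq x t; [exists y|exists x].
    by move: yB; rewrite in_setD => /andP[-> ->]; rewrite -xt eq_sym.
  by move: xB; rewrite in_setD => /andP[-> ->].
have xW : x \in W by case/missedP: xN.
have [e eM xe] := covered xW xM.
have [y yx eE] := other_end xe.
have [/matchingP[sMW degM] _] := MW.
have yW : y \in W by apply: (subsetP (sMW e eM)); rewrite eE set22.
have yN : y \notin missed W N by apply/negP=> yN; apply: maximum_edge maxN eE xN yN.
have [f fN yf] := covered yW yN.
have [/matchingP[sNW degN] /eqP nuN] := NW.
have eN : e \notin N by case/missedP: xN => _; apply.
have fM : f \notin M.
  apply/negP=> fM; case/negP: eN.
  by rewrite (degM y e f) // eE set22.
(* Exchanging [f] for [e] at [y] keeps the size and still misses [t], but gains the edge [e] of [M]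
   and loses no edge of [M]. *)
pose N' := e |: (N :\ f).
have maxN' : maximum W N'.
  apply/andP; split.
    apply: matching_setU1.
    - exact: matching_sub (subsetDl _ _) NW.1.
    - exact: sMW.
    move=> z; rewrite eE => /set2P[]->; apply/missedP; split=> // g zg.
      by rewrite !inE negb_and; case/missedP: xN => _ /(_ g zg) ->; rewrite orbT.
    by rewrite !inE; apply/andP=> -[/eqP gf gN]; apply: gf; apply: (degN y).
  by rewrite cardsU1 !inE (negPf eN) andbF -nuN (cardsD1 f N) fN.
have tN' : t \in missed W N'.
  case/missedP: (tN) => tW tN_; apply/missedP; split=> // g tg.
  rewrite !inE negb_or negb_and tN_ // orbT andbT.
  apply/eqP=> ge; move: tg; rewrite ge eE => /set2P[] tE.
    by rewrite tE eqxx in xt.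
  by rewrite -tE tN in yN.
have := bestN N'; rewrite /P maxN' tN' => /(_ isT).
apply/negP; rewrite -ltnNge.
apply: (@leq_trans #|e |: (N :&: M)|); first by rewrite cardsU1 inE (negPf eN).
apply: subset_leq_card; apply/subsetP=> g; rewrite !inE.
case/orP=> [/eqP->|/andP[gN gM]]; first by rewrite eqxx eM.
by rewrite gN gM andbT orbC; case: eqP gM fM => // -> ->.
Qed.

End Matchings.

(** * Perfect matchings from odd Gallai classes *)

Section Petersen.
Variable G : mgraph.
Hypothesis G_cubic : cubic G.
Hypothesis G_cut : forall S : {set vertex G}, #|cut S| != 1.
Implicit Types (v x y : vertex G) (e f : edge G) (S U W : {set vertex G}).
Implicit Types (F M N : {set edge G}).

Lemma degree_sum S : \sum_(v in S) #|incident v :&: [set: edge G]| = 3 * #|S|.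
Proof.
by rewrite mulnC -sum_nat_const; apply: eq_bigr => v _; rewrite setIT G_cubic.
Qed.

Lemma odd_card_cut S : odd #|cut S| = odd #|S|.
Proof. by rewrite -[cut S]setTI -handshake_parity degree_sum oddM. Qed.

Lemma odd_set_cut S : odd #|S| -> 3 <= #|cut S|.
Proof. by rewrite -odd_card_cut; have := G_cut S; case: #|_| => [|[|[|]]]. Qed.

Section GallaiClasses.
Variables (W : {set vertex G}) (M : {set edge G}).
Hypothesis maxM : maximum W M.
Hypothesis W_missed : forall v, v \in W -> exists2 N, maximum W N & v \in missed W N.

Definition gallai_class x := [set y in W | gallai W x y].

(** Adjacent vertices of [W] are related by [gallai], so an edge can leave a class only by leaving
    [W]. *)
Lemma cut_gallai_class x e : e \in cut (gallai_class x) ->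
  exists y z, [/\ ends e = [set y; z], y \in W, gallai W x y & z \notin W].
Proof.
have [y [z [yz eE]]] := ends_pair e; rewrite (cutP _ eE yz).
wlog: y z yz eE / y \in gallai_class x => [hw|].
  case yC: (y \in gallai_class x) => /=.
    by move=> zC; apply: (hw y z); rewrite ?yC.
  by move=> zC; apply: (hw z y); rewrite ?zC ?yC // 1?eq_sym // setUC.
move=> yC; rewrite yC => /= zC; exists y, z; move: yC zC; rewrite !inE.
case/andP=> yW xy; rewrite negb_and => zC; split=> //.
case/orP: zC => // /negP xz; apply/negP=> zW; apply: xz.
by apply: gallai_trans (W_missed yW) _ _ xy (gallai_edge W eE).
Qed.

(** [M] misses no vertex of the class except [x], and none of its edges leaves the class, so the
    other vertices are matched among themselves. *)
Lemma odd_gallai_class x : x \in missed W M -> odd #|gallai_class x|.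
Proof.
move=> xM; have xW : x \in W by case/missedP: xM.
have [/matchingP[sMW degM] _] := andP maxM.
have xC : x \in gallai_class x by rewrite inE xW /gallai eqxx.
have := handshake_parity M (gallai_class x).
have -> : M :&: cut (gallai_class x) = set0.
  apply/setP=> e; rewrite in_set0 in_setI; apply/negP.
  case/andP=> eM /cut_gallai_class[y [z [eE yW _ /negP[]]]].
  by apply: (subsetP (sMW e eM)); rewrite eE set22.
rewrite cards0 (big_setD1 x) //= (_ : #|incident x :&: M| = 0); last first.
  by apply/eqP; rewrite cards_eq0; move: xM; rewrite inE => /andP[].
rewrite (cardsD1 x) xC add0n oddD => /= sum_even.
rewrite (_ : #|_| = \sum_(i in gallai_class x :\ x) #|incident i :&: M|) ?sum_even //.
rewrite -sum1_card; apply: eq_bigr => y; rewrite in_setD1 inE.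
case/and3P=> yx yW xy; have [|e eM ye] := @covered _ W M _ yW.
  by apply: contra yx => yM; rewrite (gallaiP xy maxM xM yM).
apply/esym/eqP/cards1P; exists e; apply/setP=> f; rewrite !inE.
by apply/andP/eqP=> [[yf fM]|->//]; apply: degM yf ye fM eM.
Qed.

(** Distinct missed vertices have disjoint classes, each odd and hence left by at least three edges.
    Those edges end outside [W] and belong to one class each, so the degree sum over [~: W] bounds
    their number. *)
Lemma card_missed_le : #|missed W M| <= #|~: W|.
Proof.
rewrite -(leq_pmul2l (isT : 0 < 3)) -[leqRHS]degree_sum.
apply: (@leq_trans (\sum_(x in missed W M) #|cut (gallai_class x)|)).
  rewrite mulnC -sum_nat_const; apply: leq_sum => x xM.
  exact/odd_set_cut/odd_gallai_class.
rewrite handshake.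
rewrite (eq_bigr (fun x => \sum_e (e \in cut (gallai_class x) : nat))); last first.
  by move=> x _; rewrite -sum1_card big_mkcond.
rewrite exchange_big [leqRHS]big_mkcond; apply: leq_sum => e _ /=.
rewrite in_setT.
have [/existsP[x /andP[xM ex]]|/existsPn none] :=
  boolP [exists x, (x \in missed W M) && (e \in cut (gallai_class x))]; last first.
  by rewrite big1 // => x xM; have := none x; rewrite xM /= => /negbTE->.
have [y [z [eE yW xy zW]]] := cut_gallai_class ex.
rewrite (bigD1 x) //= ex big1 ?addn0 => [|x' /andP[x'M x'x]]; last first.
  apply/eqP; rewrite eqb0; apply: contra x'x => ex'.
  have [y' [z' [eE' y'W x'y' z'W]]] := cut_gallai_class ex'.
  have y'y : y' = y.
    have : y' \in ends e by rewrite eE' set21.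
    by rewrite eE => /set2P[] // y'z; rewrite -y'z y'W in zW.
  rewrite y'y in x'y'; apply/eqP/(gallaiP _ maxM x'M xM).
  by apply: (gallai_trans (W_missed yW) x'y'); rewrite gallai_sym.
by apply/card_gt0P; exists z; rewrite !inE eE set22.
Qed.

End GallaiClasses.

Theorem petersen : exists M : {set edge G}, forall v, #|incident v :&: M| = 1.
Proof.
(* Deleting a vertex lowers [nu] by at most one, so [P U] says that deleting [U] lowers it as far as
   possible. *)
pose P U := nu (~: U) + #|U| <= nu [set: vertex G].
have P0 : P set0 by rewrite /P setC0 cards0 addn0.
(* By maximality of [U], deleting one more vertex from [~: U] does not lower
   [nu], so every vertex of [~: U] is missed by some maximum matching. *)
case: (arg_maxnP (fun U : {set vertex G} => #|U|) P0) => U PU maxU.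
have [N maxN] := maximum_ex (~: U).
have W_missed v : v \in ~: U ->
    exists2 N', maximum (~: U) N' & v \in missed (~: U) N'.
  rewrite inE => vU.
  have: ~~ P (v |: U).
    by apply/negP=> /maxU /=; rewrite cardsU1 vU add1n /geq /= ltnn.
  rewrite /P cardsU1 vU -ltnNge => /(leq_ltn_trans PU).
  rewrite addnA ltn_add2r addn1 ltnS => nuU.
  have [N' /andP[/matchingP[sN' degN'] /eqP cN']] := maximum_ex (~: (v |: U)).
  have N'U : matching (~: U) N'.
    apply/matchingP; split=> // e /sN' /subset_trans; apply.
    by rewrite setCS subsetUr.
  exists N'; first by rewrite /maximum N'U eqn_leq leq_nu // cN'.
  apply/missedP; split=> [|e ve]; first by rewrite inE.
  apply/negP=> /sN' /subsetP /(_ v ve); rewrite !inE eqxx //.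
have [M maxM] := maximum_ex [set: vertex G].
have noM : missed [set: vertex G] M = set0.
  apply/eqP; rewrite -cards_eq0.
  (* Since [N] misses at most [#|U|] vertices, twice [nu (~: U)] is at least [#|~: U| - #|U|]. By
     [P U], twice [nu setT] is then at least the number of all vertices. *)
  have := card_missed_le maxN W_missed; rewrite setCK.
  have := card_missed_maximum maxN; have := card_missed_maximum maxM.
  have := cardsC U; rewrite -cardsT; move: PU; rewrite /P.
  move: #|missed _ N| #|missed _ M| #|U| #|~: U| #|_| (nu _) (nu _).
  lia.
have [/matchingP[_ degM] _] := andP maxM.
exists M => v; have [||e eM ve] := @covered _ setT M v; rewrite ?noM ?inE //.
apply/eqP/cards1P; exists e; apply/setP=> f; rewrite !inE.
by apply/andP/eqP=> [[vf fM]|->//]; apply: degM vf ve fM eM.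
Qed.

End Petersen.

(** * Removing a piece with at most two outgoing edges *)

Lemma ends_neq (G : mgraph) (e : edge G) x y : ends e = [set x; y] -> x != y.
Proof. by move=> eE; have := card_ends e; rewrite eE cards2; case: eqP. Qed.

Lemma normal_coloring_local (G : mgraph) k (c : edge G -> 'I_k) :
  (forall v, {in incident v &, injective c}) ->
  (forall e x y, ends e = [set x; y] ->
     #|colors_at c x :|: colors_at c y| \in [:: 3; 5]) ->
  normal_coloring c.
Proof.
move=> injc normc; split=> [e f ef|e].
  case/set0Pn=> v; rewrite inE => /andP[ve vf].
  by apply: contra ef => /eqP /(injc v) ->; rewrite ?inE.
have [x [y [xy eE]]] := ends_pair e.
have := normc e x y eE; rewrite /poor /rich /end_colors eE.
by rewrite big_setU1 ?inE // big_set1.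
Qed.

Lemma normal_coloring_inj (G : mgraph) k (c : edge G -> 'I_k) :
  normal_coloring c -> forall v, {in incident v &, injective c}.
Proof.
case=> prop _ v e f; rewrite !inE => ve vf cef; apply/eqP/negPn/negP=> ef.
suff: c e != c f by rewrite cef eqxx.
apply: prop ef _; apply/set0Pn; by exists v; rewrite inE ve.
Qed.

Lemma normal_coloring_card (G : mgraph) k (c : edge G -> 'I_k) e x y :
  normal_coloring c -> ends e = [set x; y] ->
  #|colors_at c x :|: colors_at c y| \in [:: 3; 5].
Proof.
case=> _ /(_ e) norm eE; have xy := ends_neq eE.
move: norm; rewrite /poor /rich /end_colors eE.
by rewrite big_setU1 ?inE // big_set1.
Qed.

Lemma labelling3 k (A : {set 'I_k}) a : #|A| = 3 -> a \in A ->
  exists m : 'I_3 -> 'I_k, [/\ injective m, m ord0 = a & [set m i | i in 'I_3] = A].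
Proof.
move=> cA aA; have uA := enum_uniq (mem A).
have sz : size (enum A) = 3 by rewrite -cardE.
have pa : perm_eq (a :: rem a (enum A)) (enum A).
  by rewrite perm_sym perm_to_rem // mem_enum.
pose s := a :: rem a (enum A); exists (fun i : 'I_3 => nth a s i).
have sz_s : size s = 3 by rewrite (perm_size pa).
have us : uniq s by rewrite (perm_uniq pa).
split=> // [i j /eqP|].
  by rewrite nth_uniq ?sz_s ?ltn_ord // => /eqP /val_inj.
apply/setP=> b; rewrite -[RHS]mem_enum -(perm_mem pa) -/s.
apply/imsetP/(nthP a) => [[i _ ->]|[i i3 <-]].
  by exists i; rewrite ?sz_s.
by rewrite sz_s in i3; exists (Ordinal i3).
Qed.

(** A digon or a triangle through [v]. The induction carries this consequence of claw-freeness,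
    which is witnessed by two or three edges and survives a reduction as soon as these do. *)
Definition short_cycle_at (G : mgraph) (v : vertex G) : Prop :=
  exists e f x y, [/\ e != f, ends e = [set v; x], ends f = [set v; y] &
    x = y \/ exists g, ends g = [set x; y]].

Section Reduction.
Variable G : mgraph.
Hypothesis G_cubic : cubic G.
Hypothesis G_cut : forall S : {set vertex G}, #|cut S| != 1.
Variables (S : {set vertex G}) (e1 e2 : edge G).
(** The implication covers a cut of two edges and also an empty cut, where [e1] and [e2] are
    arbitrary. *)
Hypothesis cutS : forall e, e \in cut S -> e1 != e2 /\ cut S = [set e1; e2].
Implicit Types (v x y : vertex G) (e f : edge G).

Lemma in_cut e x : x \notin S -> x \in ends e ->
  (e \in cut S) = ~~ [disjoint ends e & S].
Proof.
move=> xS /other_end[y yx eE]; rewrite (cutP _ eE) 1?eq_sym // (negPf xS) /=.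
by rewrite eE disjoints_subset subUset !sub1set !inE xS /= negbK.
Qed.

Lemma cut_end e : e \in cut S ->
  exists s x, [/\ ends e = [set s; x], s \in S & x \notin S].
Proof.
have [x [y [xy eE]]] := ends_pair e; rewrite (cutP _ eE xy).
case xS: (x \in S); case yS: (y \in S) => // _; first by exists x, y; rewrite yS.
by exists y, x; rewrite setUC xS.
Qed.

(** This prevents a loop: if two cut edges met at [x] outside [S], the third edge at [x] would be
    alone in the cut of [x |: S]. *)
Lemma cut_ends_disjoint e f x : e \in cut S -> f \in cut S -> x \notin S ->
  x \in ends e -> x \in ends f -> e = f.
Proof.
move=> eC fC xS xe xf; apply/eqP/negPn/negP=> ef.
have ge : exists2 g, g \notin [set e; f] & incident x = [set g; e; f].
  have sub : [set e; f] \subset incident x by rewrite subUset !sub1set !inE xe.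
  have: #|incident x :\: [set e; f]| == 1.
    by have := cardsD (incident x) [set e; f]; rewrite (setIidPr sub) cards2 ef G_cubic => ->.
  case/cards1P=> g gE; exists g.
    by have := set11 g; rewrite -gE inE => /andP[].
  by rewrite -setUA -gE setUC -[LHS](setID _ [set e; f]) (setIidPr sub).
case: ge => g gef xE.
have cE : cut S = [set e; f].
  apply/esym/eqP; rewrite eqEcard subUset !sub1set eC fC cards2 ef.
  by have [e12 ->] := cutS eC; rewrite cards2 e12.
case/negP: (G_cut (x |: S)); apply/cards1P; exists g; apply/setP=> h.
rewrite !in_set1.
have gC : g \notin cut S by rewrite cE.
have [xh|xh] := boolP (x \in ends h).
  have [y yx hE] := other_end xh.
  rewrite (cutP _ hE) 1?eq_sym // !inE eqxx (negPf yx) /=.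
  have hC := cutP S hE; rewrite eq_sym yx (negPf xS) /= in hC.
  rewrite -(hC isT).
  have : h \in incident x by rewrite inE.
  rewrite xE !in_setU !in_set1 -orbA => /or3P[]/eqP->; first by rewrite gC eqxx.
    by rewrite eC; apply/esym/eqP=> eg; rewrite eg eC in gC.
  by rewrite fC; apply/esym/eqP=> fg; rewrite fg fC in gC.
have -> : (h == g) = false.
  apply/eqP=> hg; case/negP: xh; have : g \in incident x by rewrite xE !inE eqxx.
  by rewrite inE hg.
have [y [z [yz hE]]] := ends_pair h.
have [yx zx] : y != x /\ z != x.
  by split; apply: contraNneq xh => <-; rewrite hE !inE eqxx ?orbT.
rewrite (cutP _ hE yz) !in_setU1 (negPf yx) (negPf zx) /= -(cutP _ hE yz).
by apply/negP; rewrite cE => /set2P[] hE'; rewrite hE' ?xe ?xf in xh.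
Qed.

(* The reduced graph deletes [S] and, if two edges [e1], [e2] leave [S], merges
   them into one edge, which [e1] represents. The edges to discard are exactly
   those whose [reduced_ends] do not have two elements. *)
Definition joined : {set vertex G} := (ends e1 :|: ends e2) :\: S.

Definition reduced_ends e : {set vertex G} :=
  if e \in cut S then (if e == e1 then joined else set0) else ends e :\: S.

Definition reduced_vertex := {x : vertex G | x \notin S}.
Definition reduced_edge := {e : edge G | #|reduced_ends e| == 2}.

Definition reduced_graph_ends (e : reduced_edge) : {set reduced_vertex} :=
  [set x | val x \in reduced_ends (val e)].

Lemma reduced_endsS e x : x \in reduced_ends e -> x \notin S.
Proof.
by rewrite /reduced_ends; do 2?case: ifP => _; rewrite !inE // => /andP[].
Qed.

Lemma card_reduced_graph_ends (e : reduced_edge) : #|reduced_graph_ends e| = 2.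
Proof.
rewrite -(eqP (valP e)) -(card_imset _ val_inj).
apply: eq_card => x; apply/imsetP/idP => [[y + ->]|xe]; first by rewrite inE.
by exists (Sub x (reduced_endsS xe)); rewrite ?inE.
Qed.

Definition reduced := MGraph card_reduced_graph_ends.

(** The representative in the reduced graph of an edge that has an end outside [S]. *)
Definition reroute e := if e \in cut S then e1 else e.

Lemma reroute_inj x : x \notin S -> {in incident x &, injective reroute}.
Proof.
move=> xS e f; rewrite !inE /reroute => xe xf.
case: ifP => eC; case: ifP => fC // E; first exact: cut_ends_disjoint eC fC xS xe xf.
  by have [_ C] := cutS eC; rewrite -E C set21 in fC.
by have [_ C] := cutS fC; rewrite E C set21 in eC.
Qed.

Lemma joined_ends : e1 \in cut S ->
  exists x1 x2, [/\ joined = [set x1; x2], x1 != x2,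
    x1 \in ends e1, x2 \in ends e2 & (x1 \notin S) && (x2 \notin S)].
Proof.
move=> e1C; have [e12 C] := cutS e1C.
have e2C : e2 \in cut S by rewrite C set22.
have [s1 [x1 [E1 s1S x1S]]] := cut_end e1C.
have [s2 [x2 [E2 s2S x2S]]] := cut_end e2C.
exists x1, x2; rewrite x1S x2S E1 E2 !set22; split=> //.
  rewrite /joined E1 E2; apply/setP=> z; rewrite !inE.
  have [zS|zS] /= := boolP (z \in S).
    by apply/esym/negP=> /orP[]/eqP zE; rewrite zE ?(negPf x1S) ?(negPf x2S) in zS.
  have -> : (z == s1) = false by apply: contraNF zS => /eqP->.
  by have -> : (z == s2) = false by apply: contraNF zS => /eqP->.
apply: contra e12 => /eqP x12; apply/eqP.
by apply: cut_ends_disjoint e1C e2C x1S _ _; rewrite ?E1 ?E2 ?x12 !inE eqxx orbT.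
Qed.

Lemma in_reduced_ends x e : x \notin S -> x \in ends e ->
  x \in reduced_ends (reroute e).
Proof.
move=> xS xe; rewrite /reroute /reduced_ends.
have [eC|eC] := ifPn (e \in cut S); last by rewrite (negPf eC) inE xS.
have [_ C] := cutS eC; rewrite {1}C set21 eqxx /joined !inE xS /=.
by move: eC; rewrite C !inE => /orP[]/eqP<-; rewrite xe ?orbT.
Qed.

Lemma reduced_ends_in x e : x \in reduced_ends e ->
  exists2 f, x \in ends f & reroute f = e.
Proof.
move=> xe; have xS := reduced_endsS xe; move: xe; rewrite /reduced_ends.
case: ifP => [eC|eC]; last by rewrite inE => /andP[_ xe]; exists e; rewrite /reroute ?eC.
case: eqP => [->|]; last by rewrite inE.
have [_ C] := cutS eC.
rewrite !inE xS => /orP[]; [exists e1|exists e2] => //;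
  by rewrite /reroute C !inE eqxx ?orbT.
Qed.

Lemma reduced_ends_card x e : x \notin S -> x \in ends e ->
  #|reduced_ends (reroute e)| == 2.
Proof.
move=> xS xe; rewrite /reroute.
case: ifPn => eC.
  have [_ C] := cutS eC; have e1C : e1 \in cut S by rewrite C set21.
  have [x1 [x2 [J x12 _ _ _]]] := joined_ends e1C.
  by rewrite /reduced_ends e1C eqxx J cards2 x12.
rewrite /reduced_ends (negPf eC); move: eC; rewrite (in_cut xS xe) negbK => dis.
by rewrite (setDidPl _) // card_ends.
Qed.

Lemma reduced_incident (x : vertex reduced) :
  val @: incident x = reroute @: incident (val x).
Proof.
apply/setP=> e; apply/imsetP/imsetP => [[e' xe' ->]|[f xf ->]].
  have : val x \in reduced_ends (val e') by move: xe'; rewrite !inE.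
  by case/reduced_ends_in=> f xf fE; exists f; rewrite ?inE.
rewrite inE in xf.
exists (Sub (reroute f) (reduced_ends_card (valP x) xf)) => //.
by rewrite !inE /= in_reduced_ends // (valP x).
Qed.

Lemma reduced_cubic : cubic reduced.
Proof.
move=> x; rewrite -(card_imset _ val_inj) reduced_incident.
by rewrite (card_in_imset (reroute_inj (valP x))).
Qed.

(** [X] lifts to a set [Y] of vertices of [G] with an equally large cut. Putting [S] on the side of
    the outside end of [e2] leaves [e2] uncut, and [e1] is then cut exactly when the merged edge
    is. *)
Lemma reduced_cut (X : {set vertex reduced}) : #|cut X| != 1.
Proof.
pose X0 := val @: X.
have inX0 (x : vertex reduced) : (val x \in X0) = (x \in X).
  by rewrite mem_imset //; apply: val_inj.
have X0S x : x \in X0 -> x \notin S by case/imsetP=> x' _ ->; apply: (valP x').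
pose t := [exists x in ends e2, x \in X0].
pose Y := X0 :|: (if t then S else set0).
have inY x : (x \in Y) = (if x \in S then t else x \in X0).
  rewrite in_setU; have [xS|xS] := boolP (x \in S).
    have -> : (x \in X0) = false by apply/negP=> /X0S; rewrite xS.
    by case: (t); rewrite ?xS ?in_set0.
  by case: (t); rewrite ?(negPf xS) ?in_set0 orbF.
suff -> : #|cut X| = #|cut Y| by [].
rewrite -(card_imset _ val_inj); apply: eq_card => e.
have [eC|eC] := boolP (e \in cut S).
  have [e12 C] := cutS eC; have e1C : e1 \in cut S by rewrite C set21.
  have e2C : e2 \in cut S by rewrite C set22.
  have [x1 [x2 [J x12 x1e x2e /andP[x1S x2S]]]] := joined_ends e1C.
  have [s1 [y1 [E1 s1S y1S]]] := cut_end e1C.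
  have [s2 [y2 [E2 s2S y2S]]] := cut_end e2C.
  have y1E : y1 = x1.
    by move: x1e; rewrite E1 => /set2P[]// x1s; rewrite x1s s1S in x1S.
  have y2E : y2 = x2.
    by move: x2e; rewrite E2 => /set2P[]// x2s; rewrite x2s s2S in x2S.
  subst y1 y2.
  have tE : t = (x2 \in X0).
    apply/existsP/idP=> [[z]|x2X]; last by exists x2; rewrite E2 set22.
    rewrite E2 => /andP[/set2P[->|->]] // /X0S; by rewrite s2S.
  have eY : (e \in cut Y) = if e == e1 then (x1 \in X0) (+) (x2 \in X0) else false.
    move: eC; rewrite C => /set2P[]->; rewrite ?eqxx.
      by rewrite (cutP _ E1 (ends_neq E1)) !inY s1S (negPf x1S) tE addbC.
    rewrite eq_sym (negPf e12).
    by rewrite (cutP _ E2 (ends_neq E2)) !inY s2S (negPf x2S) tE addbb.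
  rewrite eY; apply/imsetP/idP => [[e' e'X eE]|].
    have := valP e'; rewrite /= -eE /reduced_ends eC.
    case: ifP => [/eqP ee1 _|]; last by rewrite cards0.
    have e'E : ends (e' : edge reduced) = [set Sub x1 x1S; Sub x2 x2S].
      apply/setP=> z; rewrite !inE /= -eE /reduced_ends eC ee1 eqxx J !inE.
      by rewrite -!val_eqE.
    by move: e'X; rewrite (cutP _ e'E (ends_neq e'E)) -!inX0.
  case: ifP => // /eqP ee1 x12X.
  have c2 : #|reduced_ends e| == 2.
    by rewrite /reduced_ends eC ee1 eqxx J cards2 x12.
  exists (Sub e c2) => //.
  have e'E : ends (Sub e c2 : edge reduced) = [set Sub x1 x1S; Sub x2 x2S].
    apply/setP=> z; rewrite !inE /= /reduced_ends eC ee1 eqxx J !inE.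
    by rewrite -!val_eqE.
  by rewrite (cutP _ e'E (ends_neq e'E)) -!inX0.
have [x [y [xy eE]]] := ends_pair e.
have xyS : (x \in S) = (y \in S).
  by move: eC; rewrite (cutP _ eE xy); do 2 case: (_ \in _).
rewrite (cutP _ eE xy) !inY -xyS.
have [xS|xS] := boolP (x \in S).
  rewrite addbb; apply/imsetP=> -[e' _ e'E]; have := valP e'.
  rewrite /= -e'E /reduced_ends (negPf eC) eE.
  rewrite (_ : _ :\: S = set0) ?cards0 //; apply/eqP.
  by rewrite setD_eq0 subUset !sub1set -xyS xS.
have yS : y \notin S by rewrite -xyS.
have RE : reduced_ends e = [set x; y].
  rewrite /reduced_ends (negPf eC) eE; apply/setDidPl.
  by rewrite disjoints_subset subUset !sub1set !inE xS.
apply/imsetP/idP => [[e' e'X eE']|xyX].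
  have e'E : ends (e' : edge reduced) = [set Sub x xS; Sub y yS].
    by apply/setP=> z; rewrite !inE /= -eE' RE !inE -!val_eqE.
  by move: e'X; rewrite (cutP _ e'E (ends_neq e'E)) -!inX0.
have c2 : #|reduced_ends e| == 2 by rewrite RE cards2 xy.
exists (Sub e c2) => //.
have e'E : ends (Sub e c2 : edge reduced) = [set Sub x xS; Sub y yS].
  by apply/setP=> z; rewrite !inE /= RE !inE -!val_eqE.
by rewrite (cutP _ e'E (ends_neq e'E)) -!inX0.
Qed.

End Reduction.

(** * Lifting a colouring of the reduced graph *)

Section Lifting.
Variable G : mgraph.
Hypothesis G_cubic : cubic G.
Hypothesis G_cut : forall S : {set vertex G}, #|cut S| != 1.
Variables (S : {set vertex G}) (e1 e2 : edge G) (d : edge G -> 'I_3).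
Hypothesis cutS : forall e, e \in cut S -> e1 != e2 /\ cut S = [set e1; e2].
Hypothesis d_inj : forall v, v \in S -> {in incident v &, injective d}.
Hypothesis d_cut : forall e, e \in cut S -> d e = ord0.
Implicit Types (v x y : vertex G) (e f : edge G).

Local Notation R := (reduced S e1 e2).
Local Notation rr := (reroute S e1).
Local Notation rends := (reduced_ends S e1 e2).

Lemma reduced_ends_out e x y : ends e = [set x; y] -> x \notin S -> y \notin S ->
  rends e = [set x; y].
Proof.
move=> eE xS yS; rewrite /reduced_ends (cutP _ eE (ends_neq eE)).
rewrite (negPf xS) (negPf yS) /= eE; apply/setDidPl.
by rewrite disjoints_subset subUset !sub1set !inE xS.
Qed.

Lemma reduced_edge_out e x y (xS : x \notin S) (yS : y \notin S) :
  ends e = [set x; y] ->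
  exists2 e' : edge R, val e' = e & ends e' = [set (Sub x xS : vertex R); Sub y yS].
Proof.
move=> eE; have RE := reduced_ends_out eE xS yS.
have c2 : #|rends e| == 2 by rewrite RE cards2 (ends_neq eE).
exists (Sub e c2 : edge R) => //.
by apply/setP=> z; rewrite !inE /= RE !inE -!val_eqE.
Qed.

(** A digon or triangle through [x] that enters [S] has two cut edges meeting at a vertex. Outside
    [S] this is excluded by [cut_ends_disjoint]; inside [S], by [d], which is injective there but
    gives 0 to both. *)
Lemma short_cycle_out x e f y z : x \notin S -> e != f ->
  ends e = [set x; y] -> ends f = [set x; z] ->
  y = z \/ (exists g, ends g = [set y; z]) -> y \notin S.
Proof.
move=> xS ef eE fE yz; apply/negP=> yS.
have eC : e \in cut S by rewrite (cutP _ eE (ends_neq eE)) (negPf xS) yS.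
have [zS|zS] := boolP (z \in S).
  case/negP: ef; apply/eqP; apply: (cut_ends_disjoint G_cubic G_cut cutS eC _ xS).
  - by rewrite (cutP _ fE (ends_neq fE)) (negPf xS) zS.
  - by rewrite eE set21.
  - by rewrite fE set21.
case: yz => [yz|[g gE]]; first by rewrite -yz yS in zS.
have gC : g \in cut S by rewrite (cutP _ gE (ends_neq gE)) (negPf zS) yS.
have eg : e = g.
  by apply: (d_inj yS); rewrite ?inE ?eE ?gE ?set21 ?set22 // !d_cut.
have : x \in [set y; z] by rewrite -gE -eg eE set21.
by rewrite !inE (negPf (ends_neq eE)) (negPf (ends_neq fE)).
Qed.

Lemma reduced_short_cycle : (forall v, short_cycle_at v) ->
  forall x : vertex R, short_cycle_at x.
Proof.
move=> short [x xS]; have [e [f [y [z [ef eE fE yz]]]]] := short x.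
have yS := short_cycle_out xS ef eE fE yz.
have zS : z \notin S.
  apply: (short_cycle_out xS _ fE eE); first by rewrite eq_sym.
  by case: yz => [->|[g gE]]; [left | right; exists g; rewrite setUC].
have [e' e'K e'E] := reduced_edge_out xS yS eE.
have [f' f'K f'E] := reduced_edge_out xS zS fE.
exists e', f', (Sub y yS), (Sub z zS); split=> //.
- by rewrite -val_eqE e'K f'K.
- case: yz => [yz|[g gE]]; first by left; apply: val_inj.
  by have [g' _ g'E] := reduced_edge_out yS zS gE; right; exists g'.
Qed.

Lemma card_reduced : S != set0 -> #|vertex R| < #|vertex G|.
Proof.
case/set0Pn=> x xS; rewrite card_sig; apply/proper_card/properP.
by split; [apply: subset_predT | exists x; rewrite ?inE ?xS].
Qed.

(* The vertices of [S] see the three colours present at the end of [e1] outside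
   [S], so both halves of the merged edge see what they saw in the reduced
   graph. *)
Lemma lift_normal_coloring k : 2 < k -> normal_colorable R k -> normal_colorable G k.
Proof.
move=> k3 [c' normc'].
have injc' := normal_coloring_inj normc'.
have R3 := reduced_cubic G_cubic G_cut cutS.
have ctR (x : vertex R) : #|colors_at c' x| = 3.
  by rewrite (card_in_imset (injc' x)) R3.
pose cR e : option 'I_k := omap c' (insub e : option (edge R)).
have cRK (e : edge R) : cR (val e) = Some (c' e) by rewrite /cR valK.
(* [m] translates the three local colours into those seen at the end of [e1] outside [S], 0 becoming
   the colour of the merged edge. With an empty cut any injection serves. *)
have [m [injm m_cut m_out]] : exists m : 'I_3 -> 'I_k,
    [/\ injective m, forall e, e \in cut S -> cR e1 = Some (m ord0)
      & forall (x : vertex R) e, val x \in ends e1 -> e \in cut S ->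
          colors_at c' x = [set m i | i in 'I_3]].
  have [/existsP[e0 e0C]|/existsPn noC] := boolP [exists e, e \in cut S].
    have [e12 C] := cutS e0C; have e1C : e1 \in cut S by rewrite C set21.
    have [x1 [x2 [J x12 x1e x2e /andP[x1S x2S]]]] :=
      joined_ends G_cubic G_cut cutS e1C.
    have c2 : #|rends e1| == 2.
      by rewrite /reduced_ends e1C eqxx J cards2 x12.
    pose e' : edge R := Sub e1 c2; pose x : vertex R := Sub x1 x1S.
    have e'x : e' \in incident x.
      by rewrite !inE /= /reduced_ends e1C eqxx J set21.
    have [m [injm m0 m_im]] := labelling3 (ctR x) (imset_f c' e'x).
    exists m; split=> // [e _|y e ye _]; first by rewrite m0 -cRK.
    rewrite m_im; congr colors_at; apply: val_inj => /=.
    have [s [z [E sS zS]]] := cut_end e1C.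
    move: ye x1e; rewrite E => /set2P[ys|->]; first by have := valP y; rewrite /= ys sS.
    by case/set2P=> // x1s; have := x1S; rewrite {1}x1s sS.
  exists (widen_ord k3); split=> [i j [/val_inj]//|e eC|x e _ eC];
    by rewrite (negPf (noC e)) in eC.
(* Edges inside [S] have no representative in the reduced graph, so they take the default value,
   given by [d]. *)
pose c e := odflt (m (d e)) (cR (rr e)).
have cS v e : v \in S -> v \in ends e -> c e = m (d e).
  move=> vS ve; rewrite /c /reroute; case: ifP => eC.
    by rewrite (m_cut e eC) d_cut.
  rewrite /cR insubF //= /reduced_ends eC.
  have [w wv eE] := other_end ve.
  move: eC; rewrite (cutP _ eE (ends_neq eE)) vS /= => /negbFE wS.
  rewrite (_ : _ :\: S = set0) ?cards0 //; apply/eqP.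
  by rewrite setD_eq0 eE subUset !sub1set vS.
have cout (x : vertex R) e : val x \in ends e ->
    exists2 e' : edge R, val e' = rr e & c e = c' e'.
  move=> xe; have c2 := reduced_ends_card G_cubic G_cut cutS (valP x) xe.
  pose e' : edge R := Sub (rr e) c2; exists e' => //.
  by have := cRK e'; rewrite /c /= => ->.
have ctS v : v \in S -> colors_at c v = [set m i | i in 'I_3].
  move=> vS; apply/eqP; rewrite eqEcard card_imset // card_ord.
  rewrite card_in_imset ?G_cubic ?andbT => [|e f].
    by apply/subsetP=> _ /imsetP[e ve ->]; rewrite inE in ve; rewrite (cS v) ?imset_f.
  rewrite !inE => ve vf; rewrite !(cS v) // => /injm dd.
  by apply: (d_inj vS); rewrite ?inE.
have injc v : {in incident v &, injective c}.
  move=> e f; rewrite !inE => ve vf; have [vS|vS] := boolP (v \in S).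
    by rewrite !(cS v) // => /injm dd; apply: (d_inj vS); rewrite ?inE.
  have [e' e'K ->] := @cout (Sub v vS) e ve.
  have [f' f'K ->] := @cout (Sub v vS) f vf => cc.
  apply: (reroute_inj G_cubic G_cut cutS vS); rewrite ?inE //.
  rewrite -e'K -f'K; congr val; apply: (injc' (Sub v vS)) => //;
    by rewrite !inE ?e'K ?f'K /= (in_reduced_ends cutS).
have ctout (x : vertex R) : colors_at c (val x) = colors_at c' x.
  apply/eqP; rewrite eqEcard ctR card_in_imset ?G_cubic ?andbT; last exact: injc.
  apply/subsetP=> _ /imsetP[e xe ->]; rewrite inE in xe.
  have [e' e'K ->] := cout x e xe; apply: imset_f.
  by rewrite !inE e'K (in_reduced_ends cutS) // (valP x).
exists c; apply: normal_coloring_local => // e x y eE.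
have xy := ends_neq eE.
wlog xyS : x y eE xy / (x \notin S) || (y \in S) => [hw|].
  case xS: (x \in S); last by apply: hw; rewrite ?xS.
  case yS: (y \in S); first by apply: hw; rewrite ?yS ?orbT.
  by rewrite setUC; apply: hw; rewrite ?yS // 1?eq_sym // setUC.
have [xS|xS] := boolP (x \in S).
  by rewrite xS /= in xyS; rewrite !ctS // setUid card_imset // card_ord.
have [yS|yS] := boolP (y \in S); last first.
  have [e' _ e'E] := reduced_edge_out xS yS eE.
  have := normal_coloring_card normc' e'E.
  by rewrite -!ctout.
have eC : e \in cut S by rewrite (cutP _ eE xy) (negPf xS) yS.
have [e12 C] := cutS eC; have e1C : e1 \in cut S by rewrite C set21.
have [x1 [x2 [J x12 x1e x2e /andP[x1S x2S]]]] :=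
  joined_ends G_cubic G_cut cutS e1C.
have m1 := m_out (Sub x1 x1S) e x1e eC.
rewrite (ctS y yS) -m1.
have c2 : #|rends e1| == 2.
  by rewrite /reduced_ends e1C eqxx J cards2 x12.
have e'E : ends (Sub e1 c2 : edge R) = [set Sub x1 x1S; Sub x2 x2S].
  by apply/setP=> z; rewrite !inE /= /reduced_ends e1C eqxx J !inE -!val_eqE.
have xE : x = x1 \/ x = x2.
  move: (eC); rewrite C => /set2P[]ee; [left|right].
    by move: x1e; rewrite -ee eE => /set2P[]// x1y; have := x1S; rewrite {1}x1y yS.
  by move: x2e; rewrite -ee eE => /set2P[]// x2y; have := x2S; rewrite {1}x2y yS.
(* At [x1] the edge is poor, both ends seeing the same three colours; at [x2] it sees what the
   merged edge saw. *)
case: xE => xE; rewrite xE in xS *.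
  by have /= -> := ctout (Sub x1 x1S); rewrite setUid ctR.
have /= -> := ctout (Sub x2 x2S); rewrite setUC.
exact: normal_coloring_card normc' e'E.
Qed.

End Lifting.

(** * Graphs partitioned into triangles *)

Lemma greedy_3_coloring (T : finType) (r : rel T) :
  symmetric r -> irreflexive r -> (forall x, #|[set y | r x y]| <= 2) ->
  exists c : T -> 'I_3, forall x y, r x y -> c x != c y.
Proof.
move=> symr irr deg2.
suff /(_ (enum T)) [c cP] : forall s : seq T, exists c : T -> 'I_3,
    {in s &, forall x y, r x y -> c x != c y}.
  by exists c => x y; apply: cP; rewrite mem_enum.
elim=> [|a s [c cP]]; first by exists (fun=> ord0).
have [q qP] : exists q, q \notin c @: [set y | r a y].
  apply/existsP; rewrite -negb_forall; apply/negP=> /forallP all_in.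
  have := leq_trans (leq_imset_card c _) (deg2 a).
  by rewrite (eq_card (B := 'I_3)) ?card_ord // => i; rewrite all_in.
have aq y : r a y -> q != c y.
  by move=> ay; apply: contraNneq qP => ->; rewrite imset_f ?inE.
exists (fun x => if x == a then q else c x) => x y.
rewrite !inE; case: (eqVneq x a) => [->|xa]; case: (eqVneq y a) => [->|ya] //=.
- by rewrite irr.
- by move=> _ _; apply: aq.
- by move=> _ _; rewrite symr eq_sym => /aq.
- exact: cP.
Qed.

(* Colour 5 marks the perfect matching; 0, 1 and 2 colour the 2-factor. *)
Definition factor_triple (x y z : nat) : bool :=
  [&& all (mem [:: 0; 1; 2; 5]) [:: x; y; z], uniq [:: x; y; z]
    & 5 \in [:: x; y; z]].

Lemma factor_coloring (G : mgraph) : cubic G ->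
  (forall S : {set vertex G}, #|cut S| != 1) ->
  exists c : edge G -> nat, forall v e f g, incident v = [set e; f; g] ->
    factor_triple (c e) (c f) (c g).
Proof.
move=> G_cubic G_cut; have [M M1] := petersen G_cubic G_cut.
pose r (e f : edge G) :=
  [&& e != f, e \notin M, f \notin M & ends e :&: ends f != set0].
have [||e|c cP] := @greedy_3_coloring _ r.
- by move=> e f; rewrite /r eq_sym setIC; do 2 case: (_ \in M).
- by move=> e; rewrite /r eqxx.
- have [eM|eM] := boolP (e \in M).
    by rewrite (_ : [set _ | _] = set0) ?cards0 //; apply/setP=> f; rewrite !inE /r eM andbF.
  (* Each end of [e] carries exactly one further edge outside [M], which leaves at most two edges
     adjacent to [e] in the 2-factor. *)
  have deg v : v \in ends e -> #|incident v :\: M :\ e| = 1.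
    move=> ve; have := cardsD1 e (incident v :\: M).
    by rewrite !inE eM ve cardsD M1 G_cubic => -[].
  have [x [y [_ eE]]] := ends_pair e.
  have : #|(incident x :\: M :\ e) :|: (incident y :\: M :\ e)| <= 2.
    by apply: leq_trans (leq_card_setU _ _) _; rewrite !deg // eE ?set21 ?set22.
  apply/leq_trans/subset_leq_card/subsetP=> f; rewrite !inE => /and4P[ef _ fM].
  case/set0Pn=> v; rewrite eE !inE => /andP[/orP[]/eqP-> vf];
    by rewrite eq_sym ef fM vf ?orbT.
pose c5 e : nat := if e \in M then 5 else c e.
have c5P e : c5 e \in [:: 0; 1; 2; 5].
  by rewrite /c5; case: ifP => // _; case: (c e) => -[|[|[]]].
have c5_neq v e f : e != f -> v \in ends e -> v \in ends f -> c5 e != c5 f.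
  move=> ef ve vf; rewrite /c5; case: ifPn => eM; case: ifPn => fM.
  - have /cards1P[h hE] : #|incident v :&: M| == 1 by rewrite M1.
    have : e \in [set h] by rewrite -hE !inE ve.
    have : f \in [set h] by rewrite -hE !inE vf.
    by move=> /set1P fh /set1P eh; rewrite eh fh eqxx in ef.
  - by rewrite gtn_eqF // ltnS ltnW // ltnS ltnW.
  - by rewrite ltn_eqF // ltnS ltnW // ltnS ltnW.
  - apply: cP; rewrite /r ef eM fM; apply/set0Pn; exists v; by rewrite inE ve.
exists c5 => v e f g vE.
have [ef eg fg] : [/\ e != f, e != g & f != g].
  have := G_cubic v; rewrite vE => c3; split; apply/eqP=> E; move: c3.
  - by rewrite E setUid cards2; case: (_ != _).
  - by rewrite E setUAC setUid cards2; case: (_ != _).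
  - by rewrite E -setUA setUid cards2; case: (_ != _).
have [ve vf vg] : [/\ v \in ends e, v \in ends f & v \in ends g].
  have inE_v h : (v \in ends h) = (h \in incident v) by rewrite inE.
  by rewrite !inE_v vE !inE !eqxx !orbT.
rewrite /factor_triple /= !c5P !inE negb_or !(c5_neq v) //=.
have /card_gt0P[h] : 0 < #|incident v :&: M| by rewrite M1.
rewrite vE !inE => /andP[/orP[/orP[]|]/eqP-> hM]; rewrite /c5 hM; by rewrite ?orbT.
Qed.

(* The colour of the triangle edge opposite a vertex whose outer edge has
   colour [x], when the outer edges at its ends have colours of sum [s].
   Thus outer edges coloured [p] see exactly the pairs [{p+2,3}] or [{p+1,4}],
   indices mod 3, and those coloured [5] see [{3,4}]. *)
Definition opposite_color (x s : nat) : nat :=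
  if x == 5 then 3 - s else if s - 5 == x.+1 %% 3 then 4 else 3.

(** The colours at a triangle vertex with outer colour [x], when the other two vertices have outer
    colours [y] and [z]: the edge towards either of them is opposite the other. *)
Definition star_colors (x y z : nat) : seq nat :=
  [:: x; opposite_color z (x + y); opposite_color y (x + z)].

(** Claims about outer colours become a finite check settled by computation. *)
Lemma factor_tripleP (P : nat -> nat -> nat -> bool) :
  let s := [:: 0; 1; 2; 5] in
  all (fun x => all (fun y => all (fun z => factor_triple x y z ==> P x y z) s) s) s ->
  forall x y z, factor_triple x y z -> P x y z.
Proof.
move=> s all_s x y z xyz; have /and3P[/and4P[xs ys zs _] _ _] := xyz.
by move/allP/(_ x xs)/allP/(_ y ys)/allP/(_ z zs)/implyP: all_s; apply.
Qed.

Lemma star_colors_lt x y z : factor_triple x y z ->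
  uniq (star_colors x y z) && all (gtn 6) (star_colors x y z).
Proof.
move: x y z.
exact: (@factor_tripleP (fun x y z =>
  uniq (star_colors x y z) && all (gtn 6) (star_colors x y z))).
Qed.

Lemma star_colors_inner x y z : factor_triple x y z ->
  size (undup (star_colors x y z ++ star_colors y x z)) \in [:: 3; 5].
Proof.
move: x y z.
exact: (@factor_tripleP (fun x y z =>
  size (undup (star_colors x y z ++ star_colors y x z)) \in [:: 3; 5])).
Qed.

Lemma star_colors_outer x y z y' z' : factor_triple x y z -> factor_triple x y' z' ->
  size (undup (star_colors x y z ++ star_colors x y' z')) \in [:: 3; 5].
Proof.
move=> xyz xyz'; have /and3P[/and4P[_ ys zs _] _ _] := xyz.
pose s := [:: 0; 1; 2; 5].
(* The enumeration of the first triple is built into the predicate that is checked on the second. *)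
pose P x y' z' := all (fun y => all (fun z => factor_triple x y z ==>
  (size (undup (star_colors x y z ++ star_colors x y' z')) \in [:: 3; 5])) s) s.
have: P x y' z' by move: xyz'; apply: (@factor_tripleP P).
by move/allP/(_ y ys)/allP/(_ z zs)/implyP; apply.
Qed.

Lemma card_ord_seq n (s : seq nat) : all (gtn n) s ->
  #|[set i : 'I_n | val i \in s]| = size (undup s).
Proof.
move=> /allP sn; rewrite cardE -(size_map val); apply: perm_size.
apply: uniq_perm; rewrite ?undup_uniq ?(map_inj_uniq val_inj) ?enum_uniq // => i.
rewrite mem_undup; apply/mapP/idP=> [[j + ->]|si]; first by rewrite mem_enum inE.
by exists (Ordinal (sn i si)); rewrite // mem_enum inE.
Qed.

Definition nb (G : mgraph) : rel (vertex G) := adj [set: edge G].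

Lemma nbP (G : mgraph) (x y : vertex G) :
  reflect (exists e, ends e = [set x; y]) (nb x y).
Proof.
apply: (iffP existsP) => [[e /andP[_ /eqP eE]]|[e eE]]; exists e => //.
by rewrite inE eE eqxx.
Qed.

Lemma nb_sym (G : mgraph) : symmetric (@nb G).
Proof. exact: adj_sym. Qed.

Lemma nb_neq (G : mgraph) (x y : vertex G) : nb x y -> x != y.
Proof. by case/nbP=> e /ends_neq. Qed.

(** * Contracting disjoint triangles *)

Section Triangles.
Variable G : mgraph.
Hypothesis G_cubic : cubic G.
Hypothesis G_cut : forall S : {set vertex G}, #|cut S| != 1.
Hypothesis G_short : forall v : vertex G, short_cycle_at v.
Hypothesis G_simple : injective (@ends G).
Hypothesis G_no_diamond : forall x y s t : vertex G,
  nb x y -> nb x s -> nb y s -> nb x t -> nb y t -> s = t.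
Implicit Types (v x y : vertex G) (e f : edge G) (B : {set vertex G}).

(** [v] and those neighbours that share a neighbour with it: under the hypotheses of this section,
    the triangle at [v]. *)
Definition block v : {set vertex G} :=
  [set x | (x == v) || nb v x && [exists y, nb v y && nb x y]].

Variant star_spec v : Prop := StarSpec e f g a b of
  incident v = [set e; f; g] & ends e = [set v; a] & ends f = [set v; b] &
  nb a b & block v = [set v; a; b] & (forall z, z \in ends g -> z \in block v -> z = v).

(** Without parallel edges the short cycle at [v] is a triangle. If the third neighbour were
    adjacent to [a] or [b], the edge from [v] to that vertex would lie on two triangles, forming a
    diamond. *)
Lemma starP v : star_spec v.
Proof.
have [e [f [a [b [ef eE fE ab]]]]] := G_short v.
have {}ab : nb a b.
  case: ab => [ab|]; last by move/nbP.
  by case/eqP: ef; apply: G_simple; rewrite eE fE ab.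
have sub : [set e; f] \subset incident v.
  by rewrite subUset !sub1set !inE eE fE !set21.
have /cards1P[g gE] : #|incident v :\: [set e; f]| == 1.
  by rewrite cardsD (setIidPr sub) cards2 ef G_cubic.
have vE : incident v = [set e; f; g].
  by rewrite -gE -[LHS](setID _ [set e; f]) (setIidPr sub).
have gef : g \notin [set e; f] by have := set11 g; rewrite -gE inE => /andP[].
have vg : v \in ends g.
  have : g \in incident v by rewrite vE !inE eqxx !orbT.
  by rewrite inE.
have [z zv gz] := other_end vg.
have [za zb] : z != a /\ z != b.
  split; apply: contraNneq gef => zE; rewrite !inE; apply/orP; [left|right];
    by apply/eqP/G_simple; rewrite gz zE ?eE ?fE.
have [va vb vz] : [/\ nb v a, nb v b & nb v z].
  by split; apply/nbP; [exists e | exists f | exists g].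
have nbv x : nb v x -> [|| x == a, x == b | x == z].
  case/nbP=> h hE; have : h \in incident v by rewrite inE hE set21.
  have xv : x != v by have := ends_neq hE; rewrite eq_sym.
  have : x \in ends h by rewrite hE set22.
  move=> xh; rewrite vE !inE -orbA => /or3P[]/eqP hh; move: xh;
    by rewrite hh ?eE ?fE ?gz !inE (negPf xv) /= => ->; rewrite ?orbT.
have zB : z \notin block v.
  rewrite inE negb_or zv vz /=; apply/existsP=> -[w /andP[vw zw]].
  case/or3P: (nbv w vw) => /eqP wE; rewrite {}wE in vw zw.
  - case/eqP: zb; apply: (G_no_diamond (x := v) (y := a)) => //.
    by rewrite nb_sym.
  - case/eqP: za; apply: (G_no_diamond (x := v) (y := b)) => //; rewrite nb_sym //.
  - by have := nb_neq zw; rewrite eqxx.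
have BE : block v = [set v; a; b].
  apply/setP=> x; apply/idP/idP => [xB|].
    move: (xB); rewrite inE => /orP[/eqP->|/andP[vx _]].
      by rewrite !inE eqxx.
    case/or3P: (nbv x vx) => /eqP xE; rewrite !inE xE ?eqxx ?orbT //.
    by rewrite xE (negPf zB) in xB.
  rewrite !inE -orbA => /or3P[/eqP->|/eqP->|/eqP->]; first by rewrite eqxx.
    by rewrite va; apply/orP; right; apply/existsP; exists b; rewrite vb.
  by rewrite vb; apply/orP; right; apply/existsP; exists a; rewrite va nb_sym.
apply: (@StarSpec v e f g a b) => // w.
by rewrite gz => /set2P[->//|->] zB'; rewrite zB' in zB.
Qed.

Lemma card_block v : #|block v| = 3.
Proof.
have [e f g a b _ eE fE ab -> _] := starP v.
by rewrite card_set3 // ?(ends_neq eE) ?(ends_neq fE) ?(nb_neq ab).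
Qed.

Lemma block_refl v : v \in block v.
Proof. by rewrite inE eqxx. Qed.

Lemma block_eq v x : x \in block v -> block x = block v.
Proof.
have [e f g a b _ eE fE ab BE _] := starP v.
have [va vb] : nb v a /\ nb v b by split; apply/nbP; [exists e | exists f].
move=> xB; apply/esym/eqP; rewrite eqEcard !card_block leqnn andbT BE.
move: xB; rewrite BE !inE -orbA => /or3P[]/eqP->; apply/subsetP=> y;
  rewrite !inE -orbA => /or3P[]/eqP->; rewrite ?eqxx //; apply/orP; right.
- by rewrite va; apply/existsP; exists b; rewrite vb.
- by rewrite vb; apply/existsP; exists a; rewrite va nb_sym.
- by rewrite nb_sym va; apply/existsP; exists b; rewrite vb ab.
- by rewrite ab; apply/existsP; exists v; rewrite nb_sym va nb_sym vb.
- by rewrite nb_sym vb; apply/existsP; exists a; rewrite va nb_sym ab.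
- by rewrite nb_sym ab; apply/existsP; exists v; rewrite nb_sym vb nb_sym va.
Qed.

Definition outer e : bool := [forall v in ends e, ~~ (ends e \subset block v)].

Lemma outerE e x y : ends e = [set x; y] -> outer e = (block x != block y).
Proof.
move=> eE; have E v : (ends e \subset block v) = (x \in block v) && (y \in block v).
  by rewrite eE subUset !sub1set.
apply/forall_inP/idP=> [out|xy v].
  apply/eqP=> xy; have := out x; rewrite E eE set21 block_refl xy block_refl.
  by move/(_ isT).
by rewrite E => _; apply: contra xy => /andP[/block_eq-> /block_eq->].
Qed.

Definition contracted_vertex := {B : {set vertex G} | B \in codom block}.
Definition contracted_edge := {e : edge G | outer e}.

Definition contract x : contracted_vertex := Sub (block x) (codom_f block x).

Definition contracted_ends (e : contracted_edge) : {set contracted_vertex} :=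
  contract @: ends (val e).

Lemma contractE x y : (contract x == contract y) = (block x == block y).
Proof. by rewrite -val_eqE. Qed.

Lemma card_contracted_ends (e : contracted_edge) : #|contracted_ends e| = 2.
Proof.
have [x [y [_ eE]]] := ends_pair (val e); have := valP e.
by rewrite /contracted_ends eE imsetU1 imset_set1 cards2 (outerE eE) contractE => ->.
Qed.

Definition contracted := MGraph card_contracted_ends.

Lemma contract_surj (B : vertex contracted) : exists x, B = contract x.
Proof.
by have /codomP[x BE] := valP B; exists x; apply: val_inj.
Qed.

Lemma star_outer v e f g a b : incident v = [set e; f; g] ->
  ends e = [set v; a] -> ends f = [set v; b] -> block v = [set v; a; b] ->
  (forall z, z \in ends g -> z \in block v -> z = v) ->
  [/\ ~~ outer e, ~~ outer f & outer g].
Proof.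
move=> vE eE fE BE gB; rewrite (outerE eE) (outerE fE) !negbK.
rewrite !(@block_eq v) ?BE ?inE ?eqxx ?orbT //; split=> //.
have vg : v \in ends g.
  have : g \in incident v by rewrite vE !inE eqxx !orbT.
  by rewrite inE.
have [z zv gE] := other_end vg; rewrite (outerE gE); apply: contra zv => /eqP vz.
by apply/eqP/gB; rewrite ?gE ?set22 // vz block_refl.
Qed.

Lemma outer_unique v e f : v \in ends e -> v \in ends f -> outer e -> outer f -> e = f.
Proof.
have [e' f' g a b vE eE fE ab BE gB] := starP v.
have [oe of' _] := star_outer vE eE fE BE gB.
have H h : v \in ends h -> outer h -> h = g.
  move=> vh oh; have : h \in incident v by rewrite inE.
  rewrite vE !inE -orbA => /or3P[]/eqP// hE; by rewrite -hE oh in oe of'.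
by move=> ve vf /(H e ve)-> /(H f vf)->.
Qed.

Lemma outer_ex v : exists e : edge contracted, v \in ends (val e).
Proof.
have [e' f' g a b vE eE fE ab BE gB] := starP v.
have [_ _ og] := star_outer vE eE fE BE gB.
exists (Sub g og : edge contracted) => /=.
have : g \in incident v by rewrite vE !inE eqxx !orbT.
by rewrite inE.
Qed.

Definition outer_edge v : edge contracted := xchoose (outer_ex v).

Lemma outer_edgeP v : v \in ends (val (outer_edge v)).
Proof. exact: xchooseP (outer_ex v). Qed.

Lemma outer_edge_eq v (e : edge contracted) : v \in ends (val e) -> e = outer_edge v.
Proof.
move=> ve; apply/val_inj/(@outer_unique v) => //; first exact: outer_edgeP.
  exact: (valP e).
exact: (valP (outer_edge v)).
Qed.

Lemma contracted_incident v : incident (contract v : vertex contracted) = outer_edge @: block v.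
Proof.
apply/setP=> e; rewrite inE; apply/imsetP/imsetP=> [[x xe vx]|[x xB ->]].
  exists x; last exact: outer_edge_eq.
  by have /eqP := vx; rewrite contractE => /eqP ->; apply: block_refl.
exists x; first exact: outer_edgeP.
by apply/eqP; rewrite contractE (block_eq xB).
Qed.

Lemma outer_edge_inj v : {in block v &, injective outer_edge}.
Proof.
move=> x y xB yB E; apply/eqP/negPn/negP=> xy.
have := valP (outer_edge x); have xe := outer_edgeP x; have ye := outer_edgeP y.
rewrite -E in ye; have [z zx eE] := other_end xe.
have yz : y = z by move: ye; rewrite eE => /set2P[]// yx; rewrite yx eqxx in xy.
by rewrite (outerE eE) -yz (block_eq xB) (block_eq yB) eqxx.
Qed.

Lemma contracted_cubic : cubic contracted.
Proof.
move=> B; have [x ->] := contract_surj B.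
by rewrite contracted_incident (card_in_imset (@outer_edge_inj x)) card_block.
Qed.

(** The preimage of [X] is a union of blocks, so no triangle edge lies in its cut and the outer
    edges in it are those cut by [X]. *)
Lemma contracted_cut (X : {set vertex contracted}) : #|cut X| != 1.
Proof.
suff <- : #|cut [set x | (contract x : vertex contracted) \in X]| = #|cut X| by [].
rewrite -(card_imset (cut X) val_inj); apply: eq_card => e.
have [x [y [xy eE]]] := ends_pair e.
rewrite (cutP _ eE xy) !inE; apply/idP/imsetP=> [xyX|[e' e'X ee']].
  have oe : outer e.
    by rewrite (outerE eE) -contractE; apply: contraL xyX => /eqP->; rewrite addbb.
  exists (Sub e oe) => //.
  have e'E : ends (Sub e oe : edge contracted) = [set contract x; contract y].
    by rewrite /= /contracted_ends /= eE imsetU1 imset_set1.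
  by rewrite (cutP _ e'E (ends_neq e'E)).
have e'E : ends (e' : edge contracted) = [set contract x; contract y].
  by rewrite /= /contracted_ends /= -ee' eE imsetU1 imset_set1.
by move: e'X; rewrite (cutP _ e'E (ends_neq e'E)).
Qed.

Lemma triangles_normal_colorable : normal_colorable G 6.
Proof.
have [k kP] := factor_coloring contracted_cubic contracted_cut.
pose kv v := k (outer_edge v).
have triple v a b : block v = [set v; a; b] -> factor_triple (kv v) (kv a) (kv b).
  move=> BE; apply: (kP (contract v)).
  by rewrite contracted_incident BE !imsetU !imset_set1.
(* For a triangle edge [hull e] is its triangle, so the sum over [hull e :\: ends e] has a single
   term, the outer colour at the opposite vertex. *)
pose hull e := \bigcup_(x in ends e) block x.
pose c e : nat := if (insub e : option (edge contracted)) is Some e' then k e' else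
  opposite_color (\sum_(x in hull e :\: ends e) kv x) (\sum_(x in ends e) kv x).
have c_outer v e : outer e -> v \in ends e -> c e = kv v.
  move=> oe ve; rewrite /c insubT /kv; congr k; exact: outer_edge_eq.
have c_inner e x y z : ends e = [set x; y] -> block x = [set x; y; z] ->
    c e = opposite_color (kv z) (kv x + kv y).
  move=> eE BE; have xy := ends_neq eE.
  have BxBy : block y = block x by apply: block_eq; rewrite BE !inE eqxx orbT.
  have [xz yz] : z != x /\ z != y.
    by have := card_block x; rewrite BE setUC cardsU1 cards2 xy !inE;
      case: eqP => //; case: eqP.
  rewrite /c insubF ?(outerE eE) ?BxBy ?eqxx // eE.
  rewrite big_setU1 ?inE //= !big_set1.
  rewrite (_ : _ :\: _ = [set z]) ?big_set1 // /hull eE.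
  rewrite big_setU1 ?inE //= big_set1 BxBy setUid BE; apply/setP=> w.
  rewrite !inE; case: (eqVneq w z) => [->|_]; last by rewrite orbF andNb.
  by rewrite (negPf xz) (negPf yz).
have c_star v a b : block v = [set v; a; b] ->
    exists e f g, incident v = [set e; f; g] /\
      [:: c g; c e; c f] = star_colors (kv v) (kv a) (kv b).
  have [e f g a0 b0 vE eE fE _ BE gB] := starP v.
  have [_ _ og] := star_outer vE eE fE BE gB.
  have vg : v \in ends g.
    have : g \in incident v by rewrite vE !inE eqxx !orbT.
    by rewrite inE.
  have BE' : block v = [set v; b0; a0] by rewrite setUAC.
  have cg := c_outer v g og vg; have ce := c_inner _ _ _ _ eE BE.
  have cf := c_inner _ _ _ _ fE BE'; move=> BE2.
  (* The two other triangle vertices may come in either order; swapping them swaps [e] and [f]. *)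
  have [] : (a = a0 /\ b = b0) \/ (a = b0 /\ b = a0).
    have [va vb ab] : [/\ a != v, b != v & a != b].
      have := card_block v; rewrite BE2 -setUA cardsU1 cards2 !inE negb_or ![v == _]eq_sym.
      by case: (a != v); case: (b != v); case: (a != b).
    have : b \in block v by rewrite BE2 !inE eqxx !orbT.
    have : a \in block v by rewrite BE2 !inE eqxx !orbT.
    rewrite BE !inE (negPf va) (negPf vb) /=.
    by move=> /orP[]/eqP aE /orP[]/eqP bE; rewrite aE bE ?eqxx in ab *; auto.
  - by case=> -> ->; exists e, f, g; rewrite vE cg ce cf.
  case=> -> ->; exists f, e, g; rewrite vE cg ce cf; split=> //.
  by rewrite [[set e; f]]setUC.
pose col e : 'I_6 := inord (c e).
have c_col v a b : block v = [set v; a; b] ->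
    {in incident v &, injective col} /\
    colors_at col v = [set i | val i \in star_colors (kv v) (kv a) (kv b)].
  move=> BE; have := star_colors_lt (triple v a b BE).
  have [e [f [g [vE <-]]]] := c_star v a b BE => /andP[uc lt6].
  have c_mem h : h \in incident v -> c h \in [:: c g; c e; c f].
    by rewrite vE !inE -orbA => /or3P[]/eqP->; rewrite eqxx ?orbT.
  have colK h : h \in incident v -> col h = c h :> nat.
    by move=> vh; rewrite inordK //; apply: (allP lt6); apply: c_mem.
  split=> [h h' vh vh' hh'|].
    have: c h = c h' by rewrite -!colK // hh'.
    move: vh vh' uc; rewrite vE !inE -!orbA /= !inE !negb_or.
    by move=> /or3P[]/eqP-> /or3P[]/eqP-> // /and3P[/andP[ge gf] ef _] ch;
      rewrite ch eqxx in ge gf ef.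
  apply/setP=> i; rewrite inE; apply/imsetP/idP=> [[h vh ->]|].
    by rewrite /= colK // c_mem.
  have mem_col h : h \in incident v -> val i = c h -> exists2 x, x \in incident v & i = col x.
    by move=> vh ih; exists h => //; apply: val_inj; rewrite /= colK.
  by rewrite !inE => /or3P[]/eqP; apply: mem_col; rewrite vE !inE eqxx ?orbT.
exists col; apply: normal_coloring_local => [v|e x y eE].
  by have [e f g a b _ _ _ _ BE _] := starP v; have [] := c_col v a b BE.
have card_union v a b w a' b' : block v = [set v; a; b] -> block w = [set w; a'; b'] ->
    #|colors_at col v :|: colors_at col w| =
    size (undup (star_colors (kv v) (kv a) (kv b) ++ star_colors (kv w) (kv a') (kv b'))).
  move=> BE BE'; have [_ ->] := c_col v a b BE; have [_ ->] := c_col w a' b' BE'.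
  rewrite -(@card_ord_seq 6) ?all_cat; last first.
    have /andP[_ ->] := star_colors_lt (triple v a b BE).
    by have /andP[_ ->] := star_colors_lt (triple w a' b' BE').
  by apply: eq_card => i; rewrite in_setU 3!in_set mem_cat.
have [_ _ _ a b _ _ _ _ xB _] := starP x.
have [oe|ie] := boolP (outer e).
  have [_ _ _ a' b' _ _ _ _ yB _] := starP y.
  rewrite (card_union _ a b _ a' b') //.
  have <- : kv x = kv y by rewrite -!(c_outer _ e) // eE ?set21 ?set22.
  apply: star_colors_outer; first exact: triple.
  have -> : kv x = kv y by rewrite -!(c_outer _ e) // eE ?set21 ?set22.
  exact: triple.
have ByBx : block x = block y by apply/eqP; rewrite -(negbK (_ == _)) -(outerE eE).
have inner z : block x = [set x; y; z] -> #|colors_at col x :|: colors_at col y| \in [:: 3; 5].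
  move=> BE; rewrite (card_union _ y z _ x z) //; last by rewrite -ByBx BE [[set x; y]]setUC.
  exact/star_colors_inner/triple.
have /setUP[/set2P[yE|yE]|/set1P yE] : y \in [set x; a; b].
- by rewrite -xB ByBx block_refl.
- by have := ends_neq eE; rewrite yE eqxx.
- by apply: (inner b); rewrite yE.
- by apply: (inner a); rewrite yE setUAC.
Qed.

End Triangles.

(** * Claw-free graphs *)

(** Otherwise the three neighbours of [v] are distinct and pairwise non-adjacent, and together with
    [v] they induce a claw. *)
Lemma claw_free_short_cycle (G : mgraph) : cubic G -> claw_free G ->
  forall v : vertex G, short_cycle_at v.
Proof.
move=> G_cubic no_claw v; have [e1 [e2 [e3 [vE ue]]]] := card3_ex (G_cubic v).
have inv e : (v \in ends e) = (e \in incident v) by rewrite inE.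
have [[v1 v2] v3] : (v \in ends e1) * (v \in ends e2) * (v \in ends e3).
  by rewrite !inv vE !inE !eqxx !orbT.
have [x1 x1v E1] := other_end v1; have [x2 x2v E2] := other_end v2.
have [x3 x3v E3] := other_end v3.
have : [&& e1 != e2, e1 != e3 & e2 != e3].
  by move: ue; rewrite /= !inE negb_or -!andbA andbT.
case/and3P=> e12 e13 e23.
have found e f x y : e != f -> ends e = [set v; x] -> ends f = [set v; y] ->
    (x == y) || nb x y -> short_cycle_at v.
  move=> ef eE fE /orP xy; exists e, f, x, y; split=> //.
  by case: xy => [/eqP|/nbP]; auto.
have [|/norP[x12 n12]] := boolP ((x1 == x2) || nb x1 x2); first exact: found E1 E2.
have [|/norP[x13 n13]] := boolP ((x1 == x3) || nb x1 x3); first exact: found E1 E3.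
have [|/norP[x23 n23]] := boolP ((x2 == x3) || nb x2 x3); first exact: found E2 E3.
case: no_claw; pose W := [set y in [:: v; x1; x2; x3]].
have uW : uniq [:: v; x1; x2; x3].
  by rewrite /= !inE !negb_or ![v == _]eq_sym x1v x2v x3v x12 x13 x23.
have cW : #|W| = 4 by rewrite cardsE (card_uniqP uW).
have sW : [/\ ends e1 \subset W, ends e2 \subset W & ends e3 \subset W].
  by rewrite E1 E2 E3 !subUset !sub1set !inE !eqxx !orbT.
have nb_edge (e : edge G) x y : ends e = [set x; y] -> nb x y by move=> eE; apply/nbP; exists e.
have eW e : ends e \subset W -> e \in [:: e1; e2; e3].
  have [x [y [xy eE]]] := ends_pair e.
  suff : ends e \subset W -> v \in ends e.
    by move=> H /H; rewrite inv vE !inE orbA.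
  move=> eW; apply/negPn/negP=> ve.
  have xW : x \in W by apply: (subsetP eW); rewrite eE set21.
  have yW : y \in W by apply: (subsetP eW); rewrite eE set22.
  have n := nb_edge e x y eE; have n' := n; rewrite nb_sym in n'.
  move: ve xy; rewrite eE !inE negb_or ![v == _]eq_sym => /andP[xv yv].
  move: xW yW; rewrite !inE (negPf xv) (negPf yv) /=.
  move=> /or3P[]/eqP xE /or3P[]/eqP yE; rewrite xE yE ?eqxx // in n n' *;
    by rewrite ?n ?n' in n12 n13 n23.
exists W => //; have [s1 s2 s3] := sW.
(* Position 0 holds the centre [v], and the edge at position [i] leads to the vertex at position
   [i.+1], in agreement with [lift ord0 i] in [claw_ends]. *)
pose f (y : {y | y \in W}) : 'I_4 := inord (index (val y) [:: v; x1; x2; x3]).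
pose g (e : {e | ends e \subset W}) : 'I_3 := inord (index (val e) [:: e1; e2; e3]).
have fK y : f y = index (val y) [:: v; x1; x2; x3] :> nat.
  by rewrite inordK // -[4]/(size [:: v; x1; x2; x3]) index_mem; have := valP y; rewrite inE.
have gK e : g e = index (val e) [:: e1; e2; e3] :> nat.
  by rewrite inordK // -[3]/(size [:: e1; e2; e3]) index_mem; apply/eW/(valP e).
exists f, g; split.
- apply: inj_card_bij; last by rewrite card_ord card_sig -cW.
  move=> y z /(congr1 val); rewrite /= !fK => yz; apply: val_inj.
  rewrite -(nth_index v (_ : val y \in [:: v; x1; x2; x3])); last first.
    by have := valP y; rewrite inE.
  by rewrite yz nth_index //; have := valP z; rewrite inE.
- apply: inj_card_bij.
    move=> y z /(congr1 val); rewrite /= !gK => yz; apply: val_inj.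
    rewrite -(nth_index e1 (_ : val y \in [:: e1; e2; e3])); last exact/eW/(valP y).
    by rewrite yz nth_index //; apply/eW/(valP z).
  rewrite card_ord card_sig; apply: leq_trans (_ : #|[:: e1; e2; e3]| <= _).
    by rewrite (card_uniqP ue).
  by apply/subset_leq_card/subsetP=> e; rewrite !inE => /or3P[]/eqP->.
move=> [e sW_e] /=.
have W_v : v \in W by rewrite inE mem_head.
have main x i : x \in W -> ends e = [set v; x] -> index x [:: v; x1; x2; x3] = i.+1 ->
    index e [:: e1; e2; e3] = i -> claw_ends (g (Sub e sW_e)) = f @: @induced_ends _ W (Sub e sW_e).
  move=> W_x eE xi ei.
  have -> : @induced_ends _ W (Sub e sW_e) = [set Sub v W_v; Sub x W_x].
    by apply/setP=> z; rewrite !inE /= eE !inE -!val_eqE.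
  rewrite imsetU1 imset_set1 /claw_ends; congr [set _; _]; apply: val_inj.
    by rewrite /= fK /= eqxx.
  by rewrite /= fK gK; move: xi ei => /= -> ->.
have := eW e sW_e; rewrite !inE => /or3P[]/eqP ee.
- apply: (main x1 0); rewrite ?ee // ?inE /= ?eqxx ?orbT //.
  by rewrite [v == _]eq_sym (negPf x1v).
- apply: (main x2 1); rewrite ?ee // ?inE /= ?eqxx ?orbT //.
    by rewrite [v == _]eq_sym (negPf x2v) (negPf x12).
  by rewrite (negPf e12).
- apply: (main x3 2); rewrite ?ee // ?inE /= ?eqxx ?orbT //.
    by rewrite [v == _]eq_sym (negPf x3v) (negPf x13) (negPf x23).
  by rewrite (negPf e13) (negPf e23).
Qed.

(** * Removing digons and diamonds *)

(** In the degree sum over [S], inner edges count twice and cut edges once. A digon thus has at most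
    6 - 4 outgoing edges, a diamond at most 12 - 10. *)
Lemma card_cut_inner (G : mgraph) (S : {set vertex G}) (I : {set edge G}) :
  cubic G -> (forall e, e \in I -> ends e \subset S) ->
  #|cut S| + 2 * #|I| <= 3 * #|S|.
Proof.
move=> G_cubic sIS; rewrite -(degree_sum G_cubic) handshake.
rewrite mulnC -sum_nat_const -sum1_card big_mkcond [X in _ + X]big_mkcond.
rewrite [leqRHS]big_mkcond -big_split; apply: leq_sum => e _ /=.
rewrite in_setT inE; have [/sIS/setIidPl->|_] := boolP (e \in I).
  by rewrite card_ends.
by case: eqP => // ->.
Qed.

(** The piece contains a cycle of length two or four, whose edges alternate between 1 and 2. All
    other edges get 0, as [remove_piece] requires on the cut. *)
Definition local_coloring (G : mgraph) (e f e' f' h : edge G) : 'I_3 :=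
  if h \in [set e; f] then @Ordinal 3 1 isT
  else if h \in [set e'; f'] then @Ordinal 3 2 isT else ord0.

Lemma local_coloring_inj (G : mgraph) (v : vertex G) (d : edge G -> 'I_3) e f :
  cubic G -> v \in ends e -> v \in ends f -> d e != ord0 -> d f != ord0 -> d e != d f ->
  (forall h, v \in ends h -> h != e -> h != f -> d h = ord0) ->
  {in incident v &, injective d}.
Proof.
move=> G_cubic ve vf de df def d0 h h' vh vh'.
have ef : e != f by apply: contraNneq def => ->.
have /cards1P[g gE] : #|incident v :\: [set e; f]| == 1.
  rewrite cardsD (setIidPr _) ?cards2 ?ef ?G_cubic //.
  by rewrite subUset !sub1set !inE ve.
have H k : k \in incident v -> [\/ k = e, k = f | k = g /\ d k = ord0].
  move=> vk; have [->|ke] := eqVneq k e; first by constructor 1.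
  have [->|kf] := eqVneq k f; first by constructor 2.
  constructor 3; split; last by apply: d0 => //; rewrite inE in vk.
  by apply/set1P; rewrite -gE in_setD vk !inE negb_or ke kf.
case: (H h vh) => [->|->|[-> dg]]; case: (H h' vh') => [->|->|[-> dg']] //.
- by move=> E; rewrite E eqxx in def.
- by move=> E; rewrite E dg' eqxx in de.
- by move=> E; rewrite E eqxx in def.
- by move=> E; rewrite E dg' eqxx in df.
- by move=> E; rewrite -E dg eqxx in de.
- by move=> E; rewrite -E dg eqxx in df.
Qed.

Section Induction.
Variable G : mgraph.
Hypothesis G_cubic : cubic G.
Hypothesis G_cut : forall S : {set vertex G}, #|cut S| != 1.
Hypothesis G_short : forall v : vertex G, short_cycle_at v.
Hypothesis IH : forall H : mgraph, #|vertex H| < #|vertex G| -> cubic H ->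
  (forall S : {set vertex H}, #|cut S| != 1) ->
  (forall v : vertex H, short_cycle_at v) -> normal_colorable H 6.

Lemma remove_piece (S : {set vertex G}) (d : edge G -> 'I_3) : S != set0 ->
  #|cut S| <= 2 -> (forall v, v \in S -> {in incident v &, injective d}) ->
  (forall e, e \in cut S -> d e = ord0) -> normal_colorable G 6.
Proof.
move=> S0 cS d_inj d_cut.
have [e1 [e2 cutS]] : exists e1 e2, forall e, e \in cut S ->
    e1 != e2 /\ cut S = [set e1; e2].
  have [C0|] := eqVneq (cut S) set0.
    have [v _] := set0Pn _ S0; have /card_gt0P[e _] : 0 < #|incident v| by rewrite G_cubic.
    by exists e, e => f; rewrite C0 inE.
  rewrite -card_gt0 => C0; have /eqP/cards2P[e1 [e2 [e12 ->]]] : #|cut S| = 2.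
    by have := G_cut S; lia.
  by exists e1, e2.
apply: (lift_normal_coloring G_cubic G_cut cutS d_inj d_cut) => //; apply: IH.
- exact: card_reduced.
- exact: reduced_cubic.
- exact: reduced_cut.
- exact: (reduced_short_cycle G_cubic G_cut cutS d_inj d_cut).
Qed.

Lemma digon_normal_colorable (e f : edge G) :
  e != f -> ends e = ends f -> normal_colorable G 6.
Proof.
move=> ef eE.
have fe : (f == e) = false by rewrite eq_sym (negPf ef).
have I_e h : h \in [set e; f] -> ends h \subset ends e by case/set2P=> ->; rewrite ?eE.
apply: (@remove_piece (ends e) (local_coloring e e f f)).
- by rewrite -card_gt0 card_ends.
- by have := card_cut_inner G_cubic I_e; rewrite card_ends cards2 ef; lia.
- move=> v ve; apply: (@local_coloring_inj _ v _ e f) => //; first by rewrite -eE.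
  + by rewrite /local_coloring !inE eqxx.
  + by rewrite /local_coloring !inE fe eqxx.
  + by rewrite /local_coloring !inE !eqxx fe.
  by move=> h _ he hf; rewrite /local_coloring !inE (negPf he) (negPf hf).
move=> h hC; have hI : h \notin [set e; f].
  apply: contraL hC => /I_e hS; by rewrite inE (setIidPl hS) card_ends.
by move: hI; rewrite /local_coloring !inE negb_or => /andP[/negPf-> /negPf->].
Qed.

Lemma diamond_normal_colorable (u v s t : vertex G) :
  nb u v -> nb u s -> nb v s -> nb u t -> nb v t -> s != t -> normal_colorable G 6.
Proof.
move=> uv us vs ut vt st.
have neq2 (x y : vertex G) : x != y -> ((x == y) = false) * ((y == x) = false).
  by move=> xy; rewrite [y == x]eq_sym (negPf xy).
have neqs := (neq2 _ _ (nb_neq uv), neq2 _ _ (nb_neq us), neq2 _ _ (nb_neq vs),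
  neq2 _ _ (nb_neq ut), neq2 _ _ (nb_neq vt), neq2 _ _ st).
have [a aE] := nbP _ _ uv; have [b bE] := nbP _ _ us; have [c cE] := nbP _ _ vs.
have [p pE] := nbP _ _ ut; have [q qE] := nbP _ _ vt.
(* The five edges are distinct because they meet the list [u], [v], [s], [t] in different
   positions. *)
pose sig h := [seq x \in ends h | x <- [:: u; v; s; t]].
have uI : uniq [:: a; b; c; p; q].
  by apply: (@map_uniq _ _ sig); rewrite /= /sig /= aE bE cE pE qE !inE !eqxx !neqs.
pose S := [set x in [:: u; v; s; t]]; pose I := [set h in [:: a; b; c; p; q]].
have sI h : h \in I -> ends h \subset S.
  rewrite !inE => /or4P[| | |/orP[]] /eqP->;
    by rewrite ?aE ?bE ?cE ?pE ?qE subUset !sub1set !inE !eqxx ?orbT.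
have cS : #|cut S| <= 2.
  have := card_cut_inner G_cubic sI; rewrite [#|I|]cardsE (card_uniqP uI).
  have : #|S| <= 4 by rewrite cardsE card_size.
  by rewrite /=; lia.
have neqe : ((c == b) = false) * ((p == b) = false) * ((c == q) = false) * ((p == q) = false).
  move: uI; rewrite /= !inE !negb_or ![_ == b]eq_sym.
  by case/and5P=> _ /and3P[/negPf-> /negPf-> _] /andP[_ /negPf->] /negPf->.
(* The 4-cycle [u], [s], [v], [t] has edges [b], [c], [q], [p]. Its chord [a] gets 0, and so does an
   edge between [s] and [t] if the component is a complete graph on four vertices. *)
pose d := local_coloring b q c p.
have [db dq dc dp] : [/\ d b = @Ordinal 3 1 isT, d q = @Ordinal 3 1 isT,
    d c = @Ordinal 3 2 isT & d p = @Ordinal 3 2 isT].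
  by rewrite /d /local_coloring !inE !eqxx !neqe !orbT.
have d0 h : h != b -> h != q -> h != c -> h != p -> d h = ord0.
  by move=> hb hq hc hp; rewrite /d /local_coloring !inE (negPf hb) (negPf hq) (negPf hc) (negPf hp).
have far (x : vertex G) h k : x \in ends h -> x \notin ends k -> h != k.
  by move=> xh; apply: contraNneq => <-.
apply: (@remove_piece S d) => //.
- by apply/set0Pn; exists u; rewrite !inE eqxx.
- move=> x; rewrite !inE => /or4P[] /eqP->;
    [apply: (@local_coloring_inj _ _ _ b p) | apply: (@local_coloring_inj _ _ _ q c)
    |apply: (@local_coloring_inj _ _ _ b c) | apply: (@local_coloring_inj _ _ _ q p)];
    rewrite ?db ?dq ?dc ?dp ?bE ?pE ?qE ?cE ?inE ?eqxx ?orbT // => h hx h1 h2;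
    apply: d0 => //; apply: far hx _; by rewrite ?bE ?pE ?qE ?cE !inE !neqs.
move=> h hC; have /norP : ~~ ((h \in [:: b; q]) || (h \in [:: c; p])).
  apply: contraL hC => hI; rewrite inE (setIidPl _) ?card_ends //; apply: sI.
  by move: hI; rewrite !inE -!orbA => /or4P[] /eqP->; rewrite eqxx ?orbT.
by rewrite !inE !negb_or => -[/andP[hb hq] /andP[hc hp]]; apply: d0.
Qed.

Lemma claw_free_step : normal_colorable G 6.
Proof.
have [/injectiveP simple|] := boolP (injectiveb (@ends G)); last first.
  by case/injectivePn=> e [f ef /esym eE]; apply: (@digon_normal_colorable f e); rewrite 1?eq_sym.
pose diamond (w : vertex G * vertex G * vertex G * vertex G) :=
  let: (u, v, s, t) := w in [&& nb u v, nb u s, nb v s, nb u t, nb v t & s != t].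
have [/existsP[[[[u v] s] t]] /and5P[uv us vs ut /andP[vt st]]|/existsPn none] :=
  boolP [exists w, diamond w]; first exact: (diamond_normal_colorable uv us vs ut vt).
apply: triangles_normal_colorable => // u v s t uv us vs ut vt; apply/eqP/negPn/negP=> st.
by have := none (u, v, s, t); rewrite /= uv us vs ut vt st.
Qed.

End Induction.

Lemma short_cycle_normal_colorable (G : mgraph) : cubic G ->
  (forall S : {set vertex G}, #|cut S| != 1) ->
  (forall v : vertex G, short_cycle_at v) -> normal_colorable G 6.
Proof.
have [n] := ubnP #|vertex G|; elim: n G => // n IHn G; rewrite ltnS => Gn cG cutG shortG.
apply: claw_free_step => // H HG; apply: IHn; exact: leq_trans HG Gn.
Qed.

(** * Existence of the normal chromatic index *)

Definition normal_coloringb (G : mgraph) k (c : edge G -> 'I_k) : bool :=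
  [forall e, forall f, (e != f) ==> (ends e :&: ends f != set0) ==> (c e != c f)] &&
  [forall e, poor c e || rich c e].

Lemma normal_coloringP (G : mgraph) k (c : edge G -> 'I_k) :
  reflect (normal_coloring c) (normal_coloringb c).
Proof.
apply: (iffP andP) => [[/forallP prop /forallP norm]|[prop norm]]; split=> //.
- by move=> e f ef; move/forallP/(_ f)/implyP/(_ ef)/implyP: (prop e).
- by apply/forallP=> e; apply/forallP=> f; apply/implyP=> ef; apply/implyP/prop.
- exact/forallP.
Qed.

(** Finite functions make colourability decidable, so that [ex_minnP] can select the least number of
    colours. *)
Lemma normal_colorableP (G : mgraph) k :
  reflect (normal_colorable G k) [exists c : {ffun edge G -> 'I_k}, normal_coloringb c].
Proof.
apply: (iffP existsP) => [[c /normal_coloringP cN]|[c cN]]; first by exists c.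
have ct v : colors_at (finfun c) v = colors_at c v by apply/eq_imset/ffunE.
exists (finfun c); apply/normal_coloringP/normal_coloring_local => [v e f|e x y eE].
  by rewrite !ffunE; apply: normal_coloring_inj.
by rewrite !ct; apply: normal_coloring_card eE.
Qed.

Theorem theorem4 (G : mgraph) :
  claw_free G -> bridgeless G -> cubic G ->
  exists2 k : nat, is_normal_chromatic_index G k & k <= 6.
Proof.
move=> no_claw no_bridge G_cubic.
have G6 : normal_colorable G 6.
  apply: short_cycle_normal_colorable => // [S|]; first exact: bridgeless_cut.
  exact: claw_free_short_cycle.
have exk : exists k, [exists c : {ffun edge G -> 'I_k}, normal_coloringb c].
  by exists 6; apply/normal_colorableP.
case: (ex_minnP exk) => k /normal_colorableP Gk mink; exists k.
  by split=> // j /normal_colorableP /mink.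
exact/mink/normal_colorableP.
Qed.
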